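(* Let $k \ge 5$ be an odd integer, let $t=\lfloor (k-1)/2\rfloor$, and let $F$ be a graph with $p(F)\ge t+1$. Let $\mathcal{F}=\mathcal{C}_{\ge k}\cup\{F\}$, and let $\mathcal{H}=\{F[S] : S \text{ is a vertex covering of } F\}$. Then for all sufficiently large $n$, $$\mathrm{ex}_{2\text{-conn}}(n,\mathcal{F})=\mathrm{ex}(t,\mathcal{H})+t(n-t).$$
   Context: All graphs are finite and simple. A graph is $\mathcal{G}$-free, for a family $\mathcal{G}$ of graphs, if it contains no member of $\mathcal{G}$ as a (not necessarily induced) subgraph. $\mathrm{ex}(n,\mathcal{G})$ is the maximum number of edges in an $n$-vertex $\mathcal{G}$-free graph. $\mathrm{ex}_{2\text{-conn}}(n,\mathcal{G})$ is the maximum number of edges among all $n$-vertex graphs that are 2-connected and $\mathcal{G}$-free. $\mathcal{C}_{\ge k}$ is the set of all cycles of length at least $k$. A vertex covering of $F$ is a set $S\subseteq V(F)$ such that $V(F)\setminus S$ is an independent set in $F$. If $F$ is bipartite, $p(F)$ is the smallest possible size of a color class among all proper 2-colorings of $F$; if $F$ is not bipartite, $p(F)=\infty$. ''Sufficiently large $n$'' means $n\ge n_0$ for some $n_0$ depending only on $k$ and $F$. *)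

(* Defs.v *)
From HB Require Import structures.
From mathcomp Require Import all_boot.
From mathcomp Require Import boolp.

Set Implicit Arguments.
Unset Strict Implicit.
Unset Printing Implicit Defensive.

Local Open Scope nat_scope.

Record graph_on (T : finType) := GraphOn {
  edges : {set {set T}};
  _ : [forall e in edges, #|e| == 2]
}.

HB.instance Definition _ (T : finType) := [isSub for @edges T].
HB.instance Definition _ (T : finType) := [Finite of graph_on T by <:].

Record graph := Graph {
  vertex : finType;
  graph_str : graph_on vertex
}.

Definition edge_set (G : graph) : {set {set vertex G}} := edges (graph_str G).

Definition adj (G : graph) : rel (vertex G) :=
  fun x y => [set x; y] \in edge_set G.

Definition family := graph -> Prop.

(* [H] is a (not necessarily induced) subgraph of [G], up to isomorphism. *)
Definition contains (G H : graph) : Prop :=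
  exists f : vertex H -> vertex G,
    injective f /\
    forall e : {set vertex H}, e \in edge_set H -> f @: e \in edge_set G.

Definition free (Gs : family) (G : graph) : Prop :=
  forall H : graph, Gs H -> ~ contains G H.

Section Induced.
Variables (G : graph) (S : {set vertex G}).

Definition induced_edges : {set {set {x | x \in S}}} :=
  [set e : {set {x | x \in S}} | val @: e \in edge_set G].

Lemma induced_edges_card2 : [forall e in induced_edges, #|e| == 2].
Proof.
apply/forall_inP => e; rewrite inE -(card_imset _ val_inj).
by move: (val @: e); apply/forall_inP; apply: (valP (graph_str G)).
Qed.

Definition induced : graph := Graph (GraphOn induced_edges_card2).

End Induced.

Definition connected (G : graph) : Prop :=
  0 < #|vertex G| /\ forall x y : vertex G, connect (@adj G) x y.

Definition two_connected (G : graph) : Prop :=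
  2 < #|vertex G| /\
  forall X : {set vertex G}, #|X| < 2 -> connected (induced (~: X)).

(* The sequence [s] lists the vertices of the cycle in cyclic order. *)
Definition is_cycle (l : nat) (G : graph) : Prop :=
  2 < l /\ exists s : seq (vertex G),
    [/\ size s = l, uniq s, (forall x, x \in s) &
        edge_set G = [set [set x; next s x] | x in [set: vertex G]]].

Definition cycles_ge (k : nat) : family :=
  fun G => exists2 l, k <= l & is_cycle l G.

Definition add_graph (Gs : family) (F : graph) : family :=
  fun G => Gs G \/ G = F.

Definition independent (G : graph) (A : {set vertex G}) : Prop :=
  forall x y, x \in A -> y \in A -> ~~ adj x y.

Definition vertex_covering (G : graph) (S : {set vertex G}) : Prop :=
  independent (~: S).

Definition proper2 (G : graph) (c : {ffun vertex G -> bool}) : bool :=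
  [forall x, forall y, adj x y ==> (c x != c y)].

Definition bipartite (G : graph) : bool :=
  [exists c : {ffun vertex G -> bool}, proper2 c].

(* Smallest size of a colour class over all proper 2-colourings; [None] stands
   for infinity. A colour class may be empty. No class exceeds the number of
   vertices, so that number is a neutral default for [minn]. *)
Definition small_class (G : graph) : option nat :=
  if bipartite G then
    Some (\big[minn/#|vertex G|]_(c : {ffun vertex G -> bool} | proper2 c)
           \big[minn/#|vertex G|]_(b : bool) #|[set x | c x == b]|)
  else None.

Definition le_inf (m : nat) (q : option nat) : bool :=
  if q is Some q' then m <= q' else true.

(* Maxima over an empty class of graphs are 0. *)
Definition ex_num (n : nat) (Gs : family) : nat :=
  \max_(G : graph_on 'I_n | `[< free Gs (Graph G) >]) #|edges G|.

Definition ex_num_2conn (n : nat) (Gs : family) : nat :=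
  \max_(G : graph_on 'I_n |
         `[< two_connected (Graph G) /\ free Gs (Graph G) >]) #|edges G|.

Definition covering_family (F : graph) : family :=
  fun H => exists2 S : {set vertex F}, vertex_covering S & H = induced S.

(* Main.v *)
Require Import Defs.
From mathcomp Require Import all_boot.
From mathcomp Require Import boolp zify.

(** For odd [k = 2 t + 1], the lower bound is the join of an extremal graph on
[t] vertices with an independent set: a cycle has no two consecutive vertices
in the independent set, so it has at most [2 t] vertices.

For the upper bound it suffices that a large 2-connected graph of circumference
at most [2 t] with at least [t (n - t)] edges has [t] vertices meeting every
edge; almost all other vertices are then joined to all of these [t], and a
covering part of [F] inside them would extend to [F].  To find the [t] vertices,
take the graph edge-maximal.  By the argument of Kopylov and Posa, a set inducing
minimum degree more than [t] has at most [2 t] vertices, so the graph has an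
ordering in which all but boundedly many vertices have exactly [t] later
neighbours.  In a 2-connected graph of bounded circumference all paths are
bounded, so the ordering has boundedly many levels and the pigeonhole principle
gives a large [K_{t,M}].  An edge disjoint from its small side would, by
2-connectivity, lie on an ear giving a cycle of length [2 t + 1]. *)

Set Implicit Arguments.
Unset Strict Implicit.
Unset Printing Implicit Defensive.

(** * Paths and their vertex sets *)

Section Linked.

Variables (V : finType) (e : rel V).

(** A path is recorded only by its ends and its vertex set: sizes and disjointness are all that is
    asked of it, and gluing two paths becomes a union of sets. *)
Inductive linked : V -> V -> {set V} -> Prop :=
| linked_refl u : linked u u [set u]
| linked_step u v w (S : {set V}) :
    e u v -> u \notin S -> linked v w S -> linked u w (u |: S).

Lemma linked_l u v S : linked u v S -> u \in S.
Proof. by case=> *; rewrite !inE eqxx. Qed.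

Lemma linked_r u v S : linked u v S -> v \in S.
Proof. by elim=> *; rewrite !inE ?eqxx // => *; apply/orP; right. Qed.

Lemma linked_loop u S : linked u u S -> S = [set u].
Proof.
move E: {-2}u => w h; case: h E => // {}u v {}w {}S _ uS h E.
by move: (linked_r h) uS; rewrite -E => ->.
Qed.

Lemma linked_join u v w z S R : linked u v S -> e v w -> linked w z R ->
  (forall x, x \in S -> x \in R -> False) -> linked u z (S :|: R).
Proof.
move=> h evw hR; elim: h evw => {u v S} [u|u v x S euv uS _ IH] exw dj.
  apply: linked_step exw _ hR.
  by apply/negP => /dj; apply; rewrite inE.
rewrite -setUA; apply: linked_step euv _ (IH exw _) => [|y yS]; last first.
  by apply: dj; rewrite !inE yS orbT.
rewrite inE negb_or uS; apply/negP => /dj; apply.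
by rewrite !inE eqxx.
Qed.

Lemma linked_glue u v w S R : linked u v S -> linked v w R ->
  (forall x, x \in S -> x \in R -> x = v) -> linked u w (S :|: R).
Proof.
move=> h hR; elim: h hR => {u v S} [u|u v x S euv uS hS IH] hR dj.
  by rewrite (setUidPr _) // sub1set (linked_l hR).
rewrite -setUA; apply: linked_step euv _ (IH hR _) => [|y yS]; last first.
  by apply: dj; rewrite !inE yS orbT.
rewrite inE negb_or uS; apply/negP => uR.
have ux : u = x by apply: dj; rewrite // !inE eqxx.
by rewrite ux (linked_r hS) in uS.
Qed.

Lemma linked_first u v S (B : {set V}) : linked u v S -> v \in B ->
  exists w S1 S2, [/\ w \in B, linked u w S1, linked w v S2, S = S1 :|: S2 &
    (forall x, x \in S1 -> x \in S2 -> x = w) /\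
    (forall x, x \in S1 -> x \in B -> x = w)].
Proof.
move=> h; elim: h => {u v S} [u|u v x S euv uS hS IH] vB.
  exists u, [set u], [set u]; split=> //; try exact: linked_refl.
    by rewrite setUid.
  by split=> x /set1P.
have [uB|uB] := boolP (u \in B).
  exists u, [set u], (u |: S); split=> //; first exact: linked_refl.
  - exact: linked_step euv uS hS.
  - by rewrite setUA setUid.
  - by split=> y /set1P.
have [w [S1 [S2 [wB h1 h2 ES [d1 d2]]]]] := IH vB.
move: uS; rewrite ES inE negb_or => /andP[u1 u2].
exists w, (u |: S1), S2; split=> //; first exact: linked_step euv u1 h1.
  by rewrite setUA.
split=> y /setU1P[->|yS]; [by rewrite (negbTE u2)|exact: d1|
  by rewrite (negbTE uB)|exact: d2].
Qed.

Lemma linked_split u v S w : linked u v S -> w \in S ->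
  exists S1 S2, [/\ linked u w S1, linked w v S2, S = S1 :|: S2 &
    forall x, x \in S1 -> x \in S2 -> x = w].
Proof.
move=> h; elim: h => {u v S} [u|u v x S euv uS hS IH].
  move/set1P=> ->; exists [set u], [set u].
  split; rewrite ?setUid //; try exact: linked_refl; by move=> x /set1P.
have [-> _|wu] := eqVneq w u.
  exists [set u], (u |: S); split; rewrite ?setUA ?setUid //.
  - exact: linked_refl.
  - exact: linked_step euv uS hS.
  - by move=> y /set1P.
rewrite !inE (negbTE wu) => /IH[S1 [S2 [h1 h2 ES d1]]].
move: uS; rewrite ES inE negb_or => /andP[u1 u2].
exists (u |: S1), S2; split=> //; first exact: linked_step euv u1 h1.
  by rewrite setUA.
by move=> y /setU1P[->|yS]; [rewrite (negbTE u2)|exact: d1].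
Qed.

Hypothesis e_sym : symmetric e.

Lemma linked_sym u v S : linked u v S -> linked v u S.
Proof.
elim=> {u v S} [u|u v w S euv uS _ IH]; first exact: linked_refl.
rewrite setUC; apply: linked_join IH _ (linked_refl u) _; first by rewrite e_sym.
by move=> x xS /set1P xu; rewrite -xu xS in uS.
Qed.

(** The path is cut at its first vertex in [B] and then, walking back from there, at the first
    vertex in [A]. *)
Lemma linked_trim u v S (A B : {set V}) : linked u v S -> u \in A -> v \in B ->
  exists u' v' S', [/\ u' \in A, v' \in B, linked u' v' S', S' \subset S &
    (forall x, x \in S' -> x \in A -> x = u') /\
    (forall x, x \in S' -> x \in B -> x = v')].
Proof.
move=> h uA vB.
have [v' [S1 [S2 [v'B h1 _ ES [_ dB]]]]] := linked_first h vB.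
have [u' [S3 [S4 [u'A h3 _ ES1 [_ dA]]]]] := linked_first (linked_sym h1) uA.
exists u', v', S3; split=> //; first exact: linked_sym.
  by rewrite ES ES1 -setUA subsetUl.
by split=> // x xS; apply: dB; rewrite ES1 inE xS.
Qed.

(* [linked u v S] together with the edge [v u] is a cycle on [S]. *)
Definition circumference_le c :=
  forall u v S, linked u v S -> e v u -> 2 < #|S| -> #|S| <= c.

(** The second path loses its end [u] and is traversed backwards after the first; the dropped edge
    closes the cycle. If both paths are the edge [u v] the result is degenerate, hence
    [2 < #|S :|: R|] in [circumference_theta]. *)
Lemma theta_cycle u v S R : linked u v S -> linked u v R -> u != v ->
  (forall x, x \in S -> x \in R -> x = u \/ x = v) ->
  exists2 z, linked u z (S :|: R) & e z u.
Proof.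
move=> hS hR; case: hR hS => [x|{}u z {}v R0 euz uR0 hR0] hS uv d.
  by rewrite eqxx in uv.
have -> : S :|: (u |: R0) = S :|: R0.
  by rewrite setUCA (setUidPr _) // sub1set inE (linked_l hS).
exists z; rewrite 1?e_sym //.
apply: linked_glue hS (linked_sym hR0) _ => x xS xR.
have [|xu|//] := d _ xS; first by rewrite !inE xR orbT.
by rewrite xu (negbTE uR0) in xR.
Qed.

Lemma circumference_theta c u v S R : circumference_le c ->
  linked u v S -> linked u v R -> u != v ->
  (forall x, x \in S -> x \in R -> x = u \/ x = v) ->
  2 < #|S :|: R| -> #|S :|: R| <= c.
Proof. by move=> hc hS hR uv d; have [z /hc] := theta_cycle hS hR uv d; apply. Qed.

End Linked.

(** * Posa's lemma *)

Section Posa.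

Variables (V : finType) (e : rel V).
Hypotheses (e_sym : symmetric e) (e_irr : irreflexive e).

(** The indexed form of a path, for arguments that compare positions on it; only the values below
    [m] matter. *)
Definition ispath (v : nat -> V) m :=
  (forall i j, i < m -> j < m -> v i = v j -> i = j) /\
  (forall i, i.+1 < m -> e (v i) (v i.+1)).

Definition seg (v : nat -> V) i j := [set z in map v (iota i (j.+1 - i))].

Lemma segP v i j z : reflect (exists2 r, i <= r <= j & z = v r) (z \in seg v i j).
Proof.
rewrite inE; apply: (iffP mapP) => -[r].
  by rewrite mem_iota => h ->; exists r => //; lia.
by move=> h ->; exists r => //; rewrite mem_iota; lia.
Qed.

Lemma mem_seg v m i j r : ispath v m -> r < m -> j < m ->
  (v r \in seg v i j) = (i <= r <= j).
Proof.
move=> [inj _] rm jm; apply/segP/idP => [[s h /inj E]|h]; last by exists r.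
by rewrite E //; lia.
Qed.

Lemma linked_seg v m i j : ispath v m -> i <= j < m ->
  linked e (v i) (v j) (seg v i j).
Proof.
move=> hv; have [inj he] := hv.
elim: j => [|j IH] h.
  have -> : i = 0 by lia.
  rewrite (_ : seg v 0 0 = [set v 0]); first exact: linked_refl.
  by apply/setP=> z; rewrite !inE.
have [->|ij] := eqVneq i j.+1.
  rewrite (_ : seg v _ _ = [set v j.+1]); first exact: linked_refl.
  apply/setP=> z; apply/segP/set1P => [[r hr ->]|->]; last by exists j.+1 => //; lia.
  by congr v; lia.
have -> : seg v i j.+1 = seg v i j :|: [set v j.+1].
  apply/setP=> z; rewrite in_setU; apply/segP/orP.
    move=> [r hr ->]; case: (eqVneq r j.+1) => [->|rj]; first by right; rewrite inE.
    by left; apply/segP; exists r => //; lia.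
  case=> [/segP[r hr ->]|/set1P->]; first by exists r => //; lia.
  by exists j.+1 => //; lia.
have ijm : i <= j < m by lia.
have jm : j.+1 < m by lia.
apply: linked_join (IH ijm) (he j jm) (linked_refl _ _) _.
by move=> x xs /set1P E; move: xs; rewrite E (mem_seg _ hv); lia.
Qed.

Lemma ispath_rev v m : ispath v m -> ispath (fun r => v (m.-1 - r)) m.
Proof.
move=> [inj he]; split=> [i j im jm /inj E|i im]; first by lia.
have E : m.-1 - i = (m.-1 - i.+1).+1 by lia.
by rewrite e_sym E; apply: he; lia.
Qed.

Lemma linked_path u w S : linked e u w S -> exists v,
  [/\ ispath v #|S|, v 0 = u, v #|S|.-1 = w & S = seg v 0 #|S|.-1].
Proof.
elim=> {u w S} [u|u x w S eux uS hS [v [[inj he] v0 vl ES]]].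
  exists (fun=> u); rewrite cards1; split=> //.
    by split=> [[|?] [|?]|].
  by apply/setP=> z; rewrite !inE.
have S0 : 0 < #|S| by apply/card_gt0P; exists x; apply: linked_l hS.
have vS r : r < #|S| -> v r \in S.
  by move=> h; rewrite ES; apply/segP; exists r => //; lia.
exists (fun r => if r is r'.+1 then v r' else u); rewrite cardsU1 uS /= add1n.
split=> //=.
- split=> [[|i] [|j] //= hi hj E|[|i] hi].
  + by move: uS; rewrite E vS //; lia.
  + by move: uS; rewrite -E vS //; lia.
  + by rewrite (inj i j) //; lia.
  + by rewrite v0.
  + by apply: he; lia.
- by case: #|S| S0 vl.
- apply/setP=> z; rewrite in_setU1; apply/orP/segP.
    case=> [/eqP->|]; first by exists 0.
    by rewrite {1}ES => /segP[r hr ->]; exists r.+1 => //; lia.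
  case=> [[|r] h ->]; first by rewrite eqxx; left.
  by right; apply: vS; lia.
Qed.

(** 2-connectivity in terms of paths: deleting one vertex never separates two others. *)
Definition no_cut := forall c x y, x != c -> y != c ->
  exists2 S, linked e x y S & c \notin S.

Lemma link_avoiding c (A B : {set V}) u w : no_cut ->
  u \in A -> w \in B -> u != c -> w != c ->
  exists s r R, [/\ s \in A, r \in B, linked e s r R, c \notin R &
    (forall x, x \in R -> x \in A -> x = s) /\
    (forall x, x \in R -> x \in B -> x = r)].
Proof.
move=> h2 uA wB uc wc; have [S hS cS] := h2 c u w uc wc.
have [s [r [R [sA rB hR RS dd]]]] := linked_trim e_sym hS uA wB.
by exists s, r, R; split=> //; apply: contra cS; apply: subsetP.
Qed.

(** As the paths are disjoint, neither contains an end of the other, so the joint restriction on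
    indices becomes one on each path. *)
Lemma split_index v m i1 i2 j1 j2 (Q1 Q2 : {set V}) (B : pred nat) :
  linked e (v i1) (v j1) Q1 -> linked e (v i2) (v j2) Q2 ->
  (forall x, x \in Q1 -> x \in Q2 -> False) ->
  (forall r, r < m -> v r \in Q1 \/ v r \in Q2 ->
    [|| r == i1, r == i2, r == j1, r == j2 | B r]) ->
  (forall r, r < m -> v r \in Q1 -> [|| r == i1, r == j1 | B r]) /\
  (forall r, r < m -> v r \in Q2 -> [|| r == i2, r == j2 | B r]).
Proof.
move=> l1 l2 dj dP; split=> r rm h.
  have := dP r rm (or_introl h).
  case/or4P=> [->|/eqP E|->|]; rewrite ?orbT //.
    by case: (dj _ h); rewrite E; apply: linked_l l2.
  case/orP=> [/eqP E|->]; rewrite ?orbT //.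
  by case: (dj _ h); rewrite E; apply: linked_r l2.
have := dP r rm (or_intror h).
case/or4P=> [/eqP E|->|/eqP E|/orP[->|->]]; rewrite ?orbT //.
  by case: (dj _ _ h); rewrite E; apply: linked_l l1.
by case: (dj _ _ h); rewrite E; apply: linked_r l1.
Qed.

(* The two links together leave [v 0 .. v a] and enter [v b .. v m.-1], each at
   two places, one of which is [v a] (resp. [v b]).  Going from [b] to [b.+1] is
   one augmentation step of Menger's theorem. *)
Lemma two_links v m a b : no_cut -> ispath v m -> 0 < a -> a <= b -> b.+1 < m ->
  exists i1 i2 j Q1 Q2,
   [/\ i1 = a /\ i2 < a \/ i2 = a /\ i1 < a, b < j < m,
      linked e (v i1) (v b) Q1, linked e (v i2) (v j) Q2 &
      (forall x, x \in Q1 -> x \in Q2 -> False) /\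
      forall r, r < m -> v r \in Q1 \/ v r \in Q2 ->
        [|| r == i1, r == i2, r == b, r == j | a < r < b]].
Proof.
move=> h2 hv a0; have [inj he] := hv.
have neq i j : i < m -> j < m -> i != j -> v i != v j.
  by move=> im jm ij; apply/eqP => /inj E; move: ij; rewrite E // eqxx.
elim: b => [|b IH] ab bm; first by lia.
(* Base case: one link is the trivial path at [v a], the other bypasses [v a]. *)
have [E|/eqP ab'] := a =P b.+1.
  have in1 : v 0 \in seg v 0 b by rewrite (mem_seg _ hv); lia.
  have in2 : v b.+2 \in seg v b.+2 m.-1 by rewrite (mem_seg _ hv); lia.
  have [||s [z [R [/segP[i hi ->] /segP[j hj ->] hR nR [d1 d2]]]]] :=
    link_avoiding (c := v b.+1) h2 in1 in2; try by apply: neq; lia.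
  exists a, i, j, [set v b.+1], R; split=> //; try lia.
  - by rewrite E; exact: linked_refl.
  split=> [x /set1P-> xR|q qm []]; first by rewrite xR in nR.
    by move/set1P/inj => ->; lia.
  move=> qR; case: (ltngtP q b.+1) => qb.
  - have /inj-> : v q = v i; try lia; apply: d1 => //.
    by rewrite (mem_seg _ hv); lia.
  - have /inj-> : v q = v j; try lia; apply: d2 => //.
    by rewrite (mem_seg _ hv); lia.
  - by rewrite -qb qR in nR.
have {IH}[||i1 [i2 [j [Q1 [Q2 [hi hj l1 l2 [dj dP]]]]]]] := IH; try lia.
have [dP1 dP2] := split_index l1 l2 dj dP.
have bQ1 : v b.+1 \notin Q1 by apply/negP => h; have := dP1 b.+1 _ h; lia.
have l1' : linked e (v i1) (v b.+1) (Q1 :|: [set v b.+1]).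
  apply: linked_join l1 (he _ _) (linked_refl _ _) _; first by lia.
  by move=> x xQ /set1P E; rewrite E (negbTE bQ1) in xQ.
(* If [v b.+1] is not the end of the second link, the first link is prolonged to it by one edge of
   the path. *)
have [E|/eqP jb] := j =P b.+1; last first.
  have bQ2 : v b.+1 \notin Q2 by apply/negP => h; have := dP2 b.+1 _ h; lia.
  exists i1, i2, j, (Q1 :|: [set v b.+1]), Q2; split=> //; try lia.
  split=> [x /setUP[xQ /(dj _ xQ)//|/set1P-> h]|r rm h].
    by rewrite h in bQ2.
  case: h => [/setUP[/(dP1 _ rm)|/set1P/inj->]|/(dP2 _ rm)]; lia.
subst j.
(* Now the second link ends at [v b.+1]. A path [R] avoiding this vertex leads beyond it and meets
   the initial segment and both links only at its start [s]; the three possible places of [s] are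
   treated in turn. *)
pose A := (seg v 0 a :|: Q1 :|: Q2) :\ v b.+1.
have in1 : v 0 \in A.
  by rewrite in_setD1 !in_setU neq ?(mem_seg _ hv) /=; lia.
have in2 : v b.+2 \in seg v b.+2 m.-1 by rewrite (mem_seg _ hv); lia.
have [||s [z [R [sA /segP[j hj' ->] hR nR [d1 d2]]]]] :=
    link_avoiding (c := v b.+1) h2 in1 in2; try by apply: neq; lia.
have RP q : q < m -> v q \in R -> q <= a \/ b < q -> v q = s \/ q = j.
  move=> qm qR h.
  have qb : q != b.+1 by apply: contraNneq nR => <-.
  case: h => h.
    by left; apply: d1 => //; rewrite in_setD1 !in_setU neq ?(mem_seg _ hv) /=; lia.
  right; apply: inj; try lia; apply: d2 => //.
  by rewrite (mem_seg _ hv); lia.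
have RQ1 x : x \in R -> x \in Q1 -> x = s.
  move=> xR xQ; apply: d1 => //; rewrite in_setD1 !in_setU xQ !orbT andbT.
  by apply: contraNneq nR => <-.
have RQ2 x : x \in R -> x \in Q2 -> x = s.
  move=> xR xQ; apply: d1 => //; rewrite in_setD1 !in_setU xQ !orbT andbT.
  by apply: contraNneq nR => <-.
(* The first link is diverted along [R] at [s], and the two links exchange their roles. *)
have [sQ1|sQ1] := boolP (s \in Q1).
  have sQ2 : s \notin Q2 by apply/negP => /(dj _ sQ1).
  have [S1 [S2 [k1 k2 ES dS]]] := linked_split l1 sQ1.
  have sub x : x \in S1 -> x \in Q1 by rewrite ES inE => ->.
  exists i2, i1, j, Q2, (S1 :|: R); split=> //; try lia.
    by apply: linked_glue k1 hR _ => x /sub xQ xR; apply: RQ1.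
  split=> [x xQ2 /setUP[/sub xQ1|xR]|r rm].
  - exact: dj xQ1 xQ2.
  - by move: (xQ2); rewrite (RQ2 _ xR xQ2) (negbTE sQ2).
  - case=> [/(dP2 _ rm)|/setUP[/sub/(dP1 _ rm)|rR]]; try lia.
    case: (boolP (a < r < b.+1)) => [|h]; first by rewrite !orbT.
    have [|Es|->] := RP r rm rR; rewrite ?eqxx ?orbT //; first by lia.
    by move: sQ1; rewrite -Es => /(dP1 _ rm); lia.
(* The second link is diverted along [R] at [s], which frees [v b.+1] for prolonging the first. *)
have [sQ2|sQ2] := boolP (s \in Q2).
  have [S1 [S2 [k1 k2 ES dS]]] := linked_split l2 sQ2.
  have sub x : x \in S1 -> x \in Q2 by rewrite ES inE => ->.
  have bS1 : v b.+1 \notin S1.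
    apply/negP => /dS E; move: sA; rewrite in_setD1 -E ?(linked_r k2) //.
    by rewrite eqxx.
  exists i1, i2, j, (Q1 :|: [set v b.+1]), (S1 :|: R); split=> //; try lia.
    by apply: linked_glue k1 hR _ => x /sub xQ xR; apply: RQ2.
  split=> [x /setUP[xQ1|/set1P->] /setUP[xS|xR]|r rm].
  - exact: dj xQ1 (sub _ xS).
  - by move: (xQ1); rewrite (RQ1 _ xR xQ1) (negbTE sQ1).
  - by rewrite xS in bS1.
  - by rewrite xR in nR.
  - case=> [/setUP[/(dP1 _ rm)|/set1P/inj->]|/setUP[/sub/(dP2 _ rm)|rR]]; try lia.
    case: (boolP (a < r < b.+1)) => [|h]; first by rewrite !orbT.
    have [|Es|->] := RP r rm rR; rewrite ?eqxx ?orbT //; first by lia.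
    by move: sQ2; rewrite -Es => /(dP2 _ rm); lia.
(* [R] starts on the segment before [v a]: it replaces the link that does not start at [v a]. *)
have {sA} /segP[i hia Es] : s \in seg v 0 a.
  by move: sA; rewrite in_setD1 !in_setU (negbTE sQ1) (negbTE sQ2) !orbF => /andP[].
have ia : i != a.
  apply/eqP => E; case: hi => -[E' _].
    by move: sQ1; rewrite Es E -E' (linked_l l1).
  by move: sQ2; rewrite Es E -E' (linked_l l2).
have RI r : r < m -> v r \in R -> [|| r == i, r == j | a < r < b.+1].
  move=> rm rR; case: (boolP (a < r < b.+1)) => [|h]; first by rewrite !orbT.
  have [|Er|->] := RP r rm rR; rewrite ?eqxx ?orbT //; first by lia.
  by move: Er; rewrite Es => /inj->; rewrite ?eqxx //; lia.
rewrite Es in hR; case: hi => -[E' hi].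
  exists i1, i, j, (Q1 :|: [set v b.+1]), R; split=> //; try lia.
  split=> [x /setUP[xQ1|/set1P->] xR|r rm].
  - by move: (xQ1); rewrite (RQ1 _ xR xQ1) (negbTE sQ1).
  - by rewrite xR in nR.
  - case=> [/setUP[/(dP1 _ rm)|/set1P/inj->]|/(RI _ rm)]; lia.
exists i2, i, j, Q2, R; split=> //; try lia.
split=> [x xQ2 xR|r rm].
- by move: (xQ2); rewrite (RQ2 _ xR xQ2) (negbTE sQ2).
- case=> [/(dP2 _ rm)|/(RI _ rm)]; lia.
Qed.


Lemma path_index v m (D : {set V}) : ispath v m ->
  (forall z, z \in D -> z \in seg v 0 m.-1) -> 0 < m ->
  #|D| = #|[set r : 'I_m | v r \in D]|.
Proof.
move=> [inj _] hD m0; rewrite -(@card_in_imset _ _ (fun r : 'I_m => v r)).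
  apply: eq_card => z; apply/idP/imsetP => [zD|[r]]; last by rewrite inE => ? ->.
  have /segP[r hr Ez] := hD z zD.
  have rm : r < m by lia.
  by exists (Ordinal rm); rewrite ?inE -?Ez.
by move=> r s _ _ /inj E; apply: val_inj; apply: E.
Qed.

(** Walk from [v i] back to [v 0], jump to the first neighbour [v j] of [v 0] with [j > i], and go
    on to [v a]. No neighbour of [v 0] is skipped, so [D] and [v 0] itself are on this path. *)
Lemma half_cycle v m a i (D : {set V}) : ispath v m -> i < a < m ->
  e (v 0) (v a) ->
  (forall z, z \in D -> e (v 0) z /\ z \in seg v 0 a) ->
  exists S, [/\ linked e (v i) (v a) S, S \subset seg v 0 a & #|D| < #|S|].
Proof.
move=> hv iam eva hD.
have ex : exists j, (i < j) && e (v 0) (v j) by exists a; rewrite eva; lia.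
case: (ex_minnP ex) => j /andP[ij evj] jmin.
have ja : j <= a by apply: jmin; rewrite eva; lia.
have h1 : 0 <= i < m by lia.
have h2 : j <= a < m by lia.
exists (seg v 0 i :|: seg v j a); split.
- apply: linked_join (linked_sym e_sym (linked_seg hv h1)) evj (linked_seg hv h2) _.
  by move=> x /segP[r hr ->]; rewrite (mem_seg _ hv); lia.
- apply/subsetP => z; rewrite in_setU => /orP[] /segP[r hr ->];
    apply/segP; exists r => //; lia.
- have v0D : v 0 \notin D by apply/negP => /hD[]; rewrite e_irr.
  suff /subset_leq_card : v 0 |: D \subset seg v 0 i :|: seg v j a.
    by rewrite cardsU1 v0D.
  apply/subsetP => z /setU1P[->|/hD[ez /segP[r hr E]]]; rewrite in_setU.
    by rewrite (mem_seg _ hv) //; lia.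
  rewrite E !(mem_seg _ hv); try lia; rewrite E in ez.
  have [|ri] := leqP r i; first by lia.
  by have := jmin r; rewrite ri ez; lia.
Qed.

(** For a crossing with [j - i] minimal, the edges from [v 0] to [v j] and from [v m.-1] to [v i]
    give a cycle [K] that misses only the vertices strictly between [v i] and [v j], none of which
    is in [D1] or [D2]. Either nothing is missed, or the predecessors of [D1] and the set [D2] are
    counted on [K]. *)
Lemma posa_crossing v m c (D1 D2 : {set V}) i j : circumference_le e c ->
  ispath v m -> 2 < m ->
  (forall z, z \in D1 -> e (v 0) z /\ z \in seg v 0 m.-1) ->
  (forall z, z \in D2 -> e (v m.-1) z /\ z \in seg v 0 m.-1) ->
  2 < #|D1| + #|D2| -> i < j < m -> v i \in D2 -> v j \in D1 ->
  minn m (#|D1| + #|D2|) <= c.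
Proof.
move=> hc hv m2 hD1 hD2 D12 ij iD jD; have [inj _] := hv.
pose P d := [exists i : 'I_m, exists j : 'I_m,
  [&& v i \in D2, v j \in D1, i < j & d == j - i]].
have exP : exists d, P d.
  have im : i < m by lia.
  have jm : j < m by lia.
  exists (j - i); apply/existsP; exists (Ordinal im).
  by apply/existsP; exists (Ordinal jm); rewrite /= iD jD eqxx; lia.
case: (ex_minnP exP) => d /existsP[{}i /existsP[{}j /and4P[{}iD {}jD {}ij /eqP Ed]]] dmin.
have {}dmin r s : r < m -> s < m -> v r \in D2 -> v s \in D1 -> r < s -> d <= s - r.
  move=> rm sm rD sD rs; apply: dmin; apply/existsP; exists (Ordinal rm).
  by apply/existsP; exists (Ordinal sm); rewrite /= rD sD rs eqxx.
have jm := ltn_ord j.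
pose K := seg v 0 i :|: seg v j m.-1.
have h1 : 0 <= i < m by lia.
have h2 : j <= m.-1 < m by lia.
have hl : linked e (v 0) (v j) K.
  apply: linked_join (linked_seg hv h1) _ (linked_sym e_sym (linked_seg hv h2)) _.
    by rewrite e_sym; have [] := hD2 _ iD.
  by move=> x /segP[r hr ->]; rewrite (mem_seg _ hv); lia.
have Kc : 2 < #|K| -> #|K| <= c.
  by apply: hc hl _; rewrite e_sym; have [] := hD1 _ jD.
suff : minn m (#|D1| + #|D2|) <= #|K| by lia.
have vK (r : 'I_m) : (v r \in K) = (r <= i) || (j <= r).
  by rewrite in_setU !(mem_seg _ hv) ?ltn_ord //; have := ltn_ord r; lia.
rewrite (@path_index v m K) //; last 2 first.
- move=> z; rewrite in_setU => /orP[] /segP[r hr ->];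
    apply/segP; exists r => //; lia.
- by lia.
have [d1|d1] := leqP d 1.
  rewrite (_ : [set r | _] = setT) ?cardsT ?card_ord ?geq_minl //.
  by apply/setP => r; rewrite in_set in_setT vK; lia.
apply: leq_trans (geq_minr _ _) _.
rewrite (@path_index v m D1) //; [|by move=> z /hD1[]|lia].
rewrite (@path_index v m D2) //; [|by move=> z /hD2[]|lia].
set I1 := [set r | _]; set I2 := [set r | _].
have m0 : m.-1 < m by lia.
pose l := Ordinal m0.
pose pr (r : 'I_m) := Ordinal (leq_ltn_trans (leq_pred r) (ltn_ord r)).
have I1pos r : r \in I1 -> 0 < r.
  by rewrite inE lt0n => /hD1[er _]; apply: contraTneq er => ->; rewrite e_irr.
(* The predecessor of [j] is off the cycle, so [j] is left out; the last index [l], which is neither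
   a predecessor nor in [I2], makes up for it. *)
have -> : #|I1| = (#|pr @: (I1 :\ j)|).+1.
  rewrite card_in_imset; first by rewrite (cardsD1 j I1) inE jD.
  move=> r s /setD1P[_ /I1pos r0] /setD1P[_ /I1pos s0] /(congr1 val) /= E.
  by apply: val_inj => /=; lia.
(* A common index would be a crossing with gap 1, against the minimality of [d]. *)
have dis : [disjoint pr @: (I1 :\ j) & I2].
  rewrite disjoint_subset; apply/subsetP => s /imsetP[r /setD1P[_ rI] ->].
  rewrite !inE; apply/negP => prD.
  move: (I1pos _ rI) => r0; move: rI; rewrite inE => rD.
  by have := dmin r.-1 r _ (ltn_ord r) prD rD; have := ltn_ord r; lia.
have lI : l \notin pr @: (I1 :\ j) :|: I2.
  rewrite !inE negb_or; apply/andP; split; last first.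
    by apply/negP => /hD2[]; rewrite e_irr.
  apply/negP => /imsetP[r /setD1P[_ /I1pos r0] /(congr1 val) /=].
  by have := ltn_ord r; lia.
rewrite addSn -cardsUI (disjoint_setI0 dis) cards0 addn0.
rewrite -add1n -[1]/(true : nat) -lI -cardsU1; apply: subset_leq_card.
apply/subsetP => s; rewrite in_setU1 in_setU => sU; rewrite in_set vK.
case/orP: sU => [/eqP->/=|]; first by lia.
have nbt (r : 'I_m) : v r \in D1 \/ v r \in D2 -> r <= i \/ j <= r.
  move=> [rD|rD]; have := ltn_ord r.
    by have := dmin i r (ltn_ord i) (ltn_ord r) iD rD; lia.
  by have := dmin r j (ltn_ord r) (ltn_ord j) rD jD; lia.
case/orP => [/imsetP[r /setD1P[rj rI] ->]|].
  have r0 := I1pos _ rI; move: rI; rewrite inE /= => rD.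
  have : (r : nat) <> j by move=> /val_inj E; rewrite E eqxx in rj.
  by case: (nbt r (or_introl rD)); lia.
by rewrite inE => rD; case: (nbt s (or_intror rD)); lia.
Qed.

(** Without a crossing, the last vertex [v a] of [D1] does not come after the first vertex [v b] of
    [D2]. A half cycle at each end of the path and the two links between them form a cycle through
    [D1], [D2] and both ends of the path. *)
Lemma posa v m c (D1 D2 : {set V}) : no_cut -> circumference_le e c ->
  ispath v m -> 2 < m ->
  (forall z, z \in D1 -> e (v 0) z /\ z \in seg v 0 m.-1) ->
  (forall z, z \in D2 -> e (v m.-1) z /\ z \in seg v 0 m.-1) ->
  1 < #|D1| -> 1 < #|D2| -> minn m (#|D1| + #|D2|) <= c.
Proof.
move=> hcut hc hv m2 hD1 hD2 D1n D2n; have [inj _] := hv.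
have [[i [j [ij iD jD]]]|nc] :=
  EM (exists i j, [/\ i < j < m, v i \in D2 & v j \in D1]).
  by apply: posa_crossing iD jD => //; lia.
have ex1 : exists r, (r < m) && (v r \in D1).
  have /card_gt0P[z zD] : 0 < #|D1| by lia.
  by have [_ /segP[r hr E]] := hD1 _ zD; exists r; rewrite -E zD; lia.
have ex2 : exists r, (r < m) && (v r \in D2).
  have /card_gt0P[z zD] : 0 < #|D2| by lia.
  by have [_ /segP[r hr E]] := hD2 _ zD; exists r; rewrite -E zD; lia.
have ub r : (r < m) && (v r \in D1) -> r <= m by lia.
case: (ex_maxnP ex1 ub) => a /andP[am aD] amax.
case: (ex_minnP ex2) => b /andP[bm bD] bmin.
have ab : a <= b.
  by rewrite leqNgt; apply/negP => ba; apply: nc; exists b, a; split; rewrite ?ba.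
have a0 : 0 < a.
  by rewrite lt0n; apply: contraTneq aD => ->; apply/negP => /hD1[]; rewrite e_irr.
have bm1 : b.+1 < m.
  rewrite ltn_neqAle bm andbT; apply: contraTneq bD => E.
  by apply/negP => /hD2[]; rewrite -E /= e_irr.
have hD1' z : z \in D1 -> e (v 0) z /\ z \in seg v 0 a.
  move=> zD; have [ez /segP[r hr Ez]] := hD1 _ zD; split=> //.
  by apply/segP; exists r => //; apply: amax; rewrite -Ez zD; lia.
pose w r := v (m.-1 - r).
have hw : ispath w m := ispath_rev hv.
have hD2' z : z \in D2 -> e (w 0) z /\ z \in seg w 0 (m.-1 - b).
  move=> zD; have [ez /segP[r hr Ez]] := hD2 _ zD; rewrite /w subn0; split=> //.
  have br : b <= r by apply: bmin; rewrite -Ez zD; lia.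
  by apply/segP; exists (m.-1 - r); [lia|rewrite Ez; congr v; lia].
have [i1 [i2 [j [Q1 [Q2 [hi hj l1 l2 [dj dP]]]]]]] := two_links hcut hv a0 ab bm1.
have [dP1 dP2] := split_index l1 l2 dj dP.
(* The start, before [v a], of the link that does not start at [v a]. *)
pose i := if i1 == a then i2 else i1.
have ia : i < a < m by rewrite /i; case: eqP hi; lia.
have ea : e (v 0) (v a) by have [] := hD1 _ aD.
have [SA [lA sA cA]] := half_cycle hv ia ea hD1'.
have ja : m.-1 - j < m.-1 - b < m by lia.
have eb : e (w 0) (w (m.-1 - b)).
  rewrite /w subn0 (_ : m.-1 - _ = b); last by lia.
  by have [] := hD2 _ bD.
have [SB [lB sB cB]] := half_cycle hw ja eb hD2'.
have {lB} lB : linked e (v b) (v j) SB.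
  by apply: (linked_sym e_sym); move: lB; rewrite /w !subKn //; lia.
have inA x : x \in SA -> exists2 r, r <= a & x = v r.
  by move/(subsetP sA)/segP=> [r hr ->]; exists r => //; lia.
have inB x : x \in SB -> exists2 r, b <= r < m & x = v r.
  by move/(subsetP sB)/segP=> [r hr ->]; exists (m.-1 - r) => //; lia.
(* The halves share at most [v a], when [a = b]; the two ends of the path, counted by the strict
   inequalities [cA] and [cB], outweigh this loss. *)
have cAB : #|SA| + #|SB| <= #|SA :|: SB|.+1.
  rewrite -cardsUI -addn1 leq_add2l.
  have : SA :&: SB \subset [set v a].
    apply/subsetP => x /setIP[/inA[r hr ->] /inB[s hs /inj E]].
    by rewrite inE; apply/eqP; congr v; lia.
  by move/subset_leq_card; rewrite cards1.
have vij r s : r < m -> s < m -> r != s -> v r != v s.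
  by move=> rm sm; apply: contraNneq => /inj->.
have fin Q Q' : (2 < #|SA :|: Q :|: SB :|: Q'| ->
    #|SA :|: Q :|: SB :|: Q'| <= c) -> minn m (#|D1| + #|D2|) <= c.
  have : #|SA :|: SB| <= #|SA :|: Q :|: SB :|: Q'|.
    apply: subset_leq_card; apply/subsetP => x; rewrite !in_setU.
    by case/orP=> ->; rewrite ?orbT.
  lia.
(* The cycle is the first half, the link from [v a], the second half, and the other link back to
   [v i]; the second half is traversed in the direction that fits. *)
have [Ei|ne] := eqVneq i1 a.
  have Eii : i = i2 by rewrite /i Ei eqxx.
  apply: (fin Q1 Q2); apply: (circumference_theta e_sym hc (u := v i) (v := v j)).
  - apply: linked_glue lB _; first apply: linked_glue lA _ _.
    + by rewrite -Ei; exact: l1.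
    + move=> x /inA[r ra ->] /dP1 h; congr v; lia.
    + by move=> x /setUP[/inA[s sa ->]|xQ] /inB[r hr Ex];
        [move/inj: Ex|rewrite Ex in xQ *; have := dP1 r _ xQ] => h; congr v; lia.
  - by rewrite Eii; exact: l2.
  - by apply: vij; lia.
  - move=> x /setUP[/setUP[/inA[r hr ->]|xQ1 /(dj _ xQ1)//]|/inB[r hr ->]] xQ2.
    + by left; congr v; have := dP2 r _ xQ2; lia.
    + by right; congr v; have := dP2 r _ xQ2; lia.
have Ei2 : i2 = a by lia.
have Eii : i = i1 by rewrite /i (negbTE ne).
have ab' : a <> b.
  by move=> E; apply: dj (linked_r l1) _; rewrite -E -Ei2 (linked_l l2).
apply: (fin Q2 Q1); apply: (circumference_theta e_sym hc (u := v i) (v := v b)).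
- apply: linked_glue (linked_sym e_sym lB) _; first apply: linked_glue lA _ _.
  + by rewrite -Ei2; exact: l2.
  + move=> x /inA[r ra ->] /dP2 h; congr v; lia.
  + by move=> x /setUP[/inA[s sa ->]|xQ] /inB[r hr Ex];
      [move/inj: Ex|rewrite Ex in xQ *; have := dP2 r _ xQ] => h; congr v; lia.
- by rewrite Eii; exact: l1.
- by apply: vij; lia.
- move=> x /setUP[/setUP[/inA[r hr ->]|xQ2 /dj/(_ xQ2)//]|/inB[r hr ->]] xQ1.
  + by left; congr v; have := dP1 r _ xQ1; lia.
  + by right; congr v; have := dP1 r _ xQ1; lia.
Qed.

End Posa.

(** * Path lengths *)

Section Structure.

Variables (V : finType) (e : rel V).
Hypotheses (e_sym : symmetric e) (e_irr : irreflexive e).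

Lemma linked_inner u v S x y : linked e u v S -> x \in S -> y \in S ->
  exists2 R, linked e x y R & R \subset S.
Proof.
move=> h xS yS; have [S1 [S2 [h1 h2 ES _]]] := linked_split h xS.
move: yS; rewrite ES inE => /orP[y1|y2].
  have [R1 [R2 [_ k2 E _]]] := linked_split h1 y1.
  exists R2; first exact: linked_sym.
  by rewrite E -setUA; apply: subset_trans (subsetUr _ _); apply: subsetUl.
have [R1 [R2 [k1 _ E _]]] := linked_split h2 y2.
exists R1 => //.
by rewrite E; apply: subset_trans (subsetUr _ _); apply: subsetUl.
Qed.

(** The part of the path between consecutive visits to [C] closes up through [C] to a cycle, or is
    an edge, and so has at most [c] vertices. Each part is charged to the visit at which it
    starts. *)
Lemma linked_card_ear c (C : {set V}) x y : 1 < c -> circumference_le e c ->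
  linked e x y C ->
  forall S u w, linked e u w S -> u \in C -> w \in C -> #|S| <= c * #|S :&: C|.
Proof.
move=> c1 hc hC S; have [n] := ubnP #|S|; elim: n S => // n IH S Sn u w hS.
case: hS Sn => {u w S} [u|u z w S euz uS hS] Sn uC wC.
  by rewrite (setIidPl _) ?sub1set // cards1; lia.
have [w' [S1 [S2 [wC' h1 h2 ES [d1 d2]]]]] := linked_first hS wC.
have [uS1 uS2] : u \notin S1 /\ u \notin S2.
  by apply/andP; rewrite -negb_or -in_setU -ES.
have IH2 : #|S2| <= c * #|S2 :&: C|.
  apply: IH h2 _ _ => //.
  have : #|S2| <= #|S| by rewrite ES subset_leq_card ?subsetUr.
  by move: Sn; rewrite cardsU1 uS; lia.
have uw' : u != w' by apply: contraNneq uS1 => ->; apply: linked_r h1.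
have [A hA AC] := linked_inner hC uC wC'.
have ear : #|u |: S1| <= c.
  have := @circumference_theta _ _ e_sym c u w' (u |: S1) A hc.
  have : #|u |: S1| <= #|(u |: S1) :|: A| by rewrite subset_leq_card ?subsetUl.
  have E2 : 1 < #|u |: S1|.
    by rewrite cardsU1 uS1; have := linked_l h1; rewrite (cardsD1 z); case: (_ \in _).
  move=> le /(_ (linked_step euz uS1 h1) hA uw') th.
  have {th} : 2 < #|u |: S1 :|: A| -> #|u |: S1 :|: A| <= c.
    apply: th => q /setU1P[->|qS qA]; first by left.
    by right; apply: d2 => //; apply: subsetP qA.
  lia.
have : #|u |: S| <= #|u |: S1| + #|S2|.
  by rewrite ES setUA; apply: leq_card_setU.
have : #|S2 :&: C|.+1 <= #|(u |: S) :&: C|.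
  rewrite -add1n -[1]/(true : nat) -(_ : u \notin S2 :&: C); last first.
    by rewrite inE (negbTE uS2).
  rewrite -cardsU1; apply: subset_leq_card; apply/subsetP => q.
  rewrite ES !inE; case: eqP => [->|_]; first by rewrite uC.
  by case/andP=> -> ->; rewrite orbT.
move=> k1 k2; apply: leq_trans k2 _; apply: leq_trans (leq_add ear IH2) _.
by rewrite -mulnS leq_mul2l k1 orbT.
Qed.

(* By [two_links] the ends of the path lie on a common cycle, which cuts the
   path into ears. *)
Lemma linked_card c u w S : 1 < c -> no_cut e -> circumference_le e c ->
  linked e u w S -> #|S| <= c * c.
Proof.
move=> c1 hcut hc hS; have [S2|S2] := leqP #|S| 2.
  by nia.
have [v [hv v0 vl ES]] := linked_path hS; have [inj he] := hv.
set m := #|S| in S2 hv v0 vl ES inj he *.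
(* With [a = 1] and [b = m - 2] the links start at the first two and end at the last two vertices of
   the path; adding end edges of the path turns them into two paths from [u] to [w] with only these
   ends in common. *)
have [|||i1 [i2 [j [Q1 [Q2 [hi hj l1 l2 [dj dP]]]]]]] :=
  @two_links _ _ e_sym v m 1 (m - 2) hcut hv; try lia.
have [dP1 dP2] := split_index l1 l2 dj dP.
have jm : j = m.-1 by lia.
have vij r s : r < m -> s < m -> r != s -> v r != v s.
  by move=> rm sm; apply: contraNneq => /inj->.
suff [S1 [S2' [k1 k2 d2 c2]]] : exists S1 S2', [/\ linked e u w S1,
    linked e u w S2', (forall x, x \in S1 -> x \in S2' -> x = u \/ x = w) &
    2 < #|S1 :|: S2'|].
  have uw : u != w by rewrite -v0 -vl vij; lia.
  have [z hC ez] := theta_cycle e_sym k1 k2 uw d2.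
  have wC : w \in S1 :|: S2' by rewrite inE (linked_r k1).
  apply: leq_trans (linked_card_ear c1 hc hC hS (linked_l hC) wC) _.
  rewrite leq_mul2l (leq_trans _ (hc _ _ _ hC ez c2)) ?orbT //.
  by rewrite subset_leq_card ?subsetIr.
have ends x : x \in S -> exists2 r, r < m & x = v r.
  by rewrite ES => /segP[r hr ->]; exists r => //; lia.
have card3 r (A : {set V}) : 0 < r < m.-1 -> v 0 \in A -> v m.-1 \in A ->
    v r \in A -> 2 < #|A|.
  move=> hr A0 A1 Ar; have : [set v 0; v m.-1; v r] \subset A.
    by apply/subsetP => x; rewrite !inE => /orP[/orP[]|] /eqP->.
  move/subset_leq_card; apply: leq_trans.
  by rewrite -setUA !cardsU1 !inE cards1 negb_or !vij //; lia.
have eb : e (v (m - 2)) (v m.-1).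
  by rewrite (_ : m.-1 = (m - 2).+1); [apply: he; lia|lia].
rewrite jm in l2 dP dP2; rewrite -v0 -vl.
have wQ1 : v m.-1 \notin Q1 by apply/negP => h; exact: dj h (linked_r l2).
case: hi => [[E1 E2]|[E2 E1]].
- have E3 : i2 = 0 by lia.
  rewrite E1 E3 in l1 l2 dP dP1 dP2 *.
  have Q10 : v 0 \notin Q1 by apply/negP => /dj; apply; apply: linked_l l2.
  have h0 : linked e (v 0) (v (m - 2)) (v 0 |: Q1).
    by apply: linked_step l1 => //; apply: he; lia.
  exists (v 0 |: Q1 :|: [set v m.-1]), Q2; split=> //.
  + apply: linked_join h0 eb (linked_refl _ _) _.
    move=> x xS /set1P Ex; move: xS; rewrite Ex in_setU1 (negbTE wQ1) orbF.
    by rewrite (negbTE (vij _ _ _ _ _)) //; lia.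
  + move=> x; rewrite !inE => /orP[/orP[/eqP->|xQ]|/eqP->]; [by left| |by right].
    by move/dj: xQ => h /h.
  + by apply: (card3 1); rewrite ?inE ?(linked_l l1) ?eqxx ?orbT //; lia.
- have E3 : i1 = 0 by lia.
  rewrite E2 E3 in l1 l2 dP dP1 dP2 *.
  have Q20 : v 0 \notin Q2 by apply/negP => /(dj _ (linked_l l1)).
  exists (Q1 :|: [set v m.-1]), (v 0 |: Q2); split.
  + apply: linked_join l1 eb (linked_refl _ _) _.
    by move=> x xS /set1P Ex; move: xS; rewrite Ex (negbTE wQ1).
  + by apply: linked_step l2 => //; apply: he; lia.
  + move=> x; rewrite !inE => /orP[xQ|/eqP->]; last by right.
    by case/orP=> [/eqP->|/(dj _ xQ)//]; left.
  + apply: (card3 (m - 2)); rewrite ?inE ?(linked_r l1) ?eqxx ?orbT //; lia.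
Qed.

End Structure.

(** * Large bicliques *)

Section Biclique.

Variables (V : finType) (e : rel V) (t L : nat) (T W : {set V}).
Hypotheses (e_sym : symmetric e) (e_irr : irreflexive e).
Hypotheses (t1 : 1 < t) (hcut : no_cut e) (hc : circumference_le e (2 * t)).
Hypothesis linked_le : forall u v S, linked e u v S -> #|S| <= L.
Hypotheses (cT : #|T| = t) (cW : L + t <= #|W|).
Hypotheses (eTW : forall x y, x \in T -> y \in W -> e x y).

Let TW x : x \in T -> x \in W -> False.
Proof. by move=> xT /(eTW xT); rewrite e_irr. Qed.

(** The path alternates between [T] and [W]: it uses [u], [v], all [n] vertices of [X], and [n + 1]
    vertices of [Y] between them. *)
Lemma linked_zigzag n (X Y : {set V}) u v : v \in T -> u \in T -> u != v ->
  X \subset T -> u \notin X -> v \notin X -> #|X| = n -> Y \subset W -> n < #|Y| ->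
  exists R, [/\ linked e v u R, #|R| = n.*2 + 3 &
    forall z, z \in R -> [\/ z \in X, z \in Y, z = u | z = v]].
Proof.
elim: n X Y v => [|n IH] X Y v vT uT uv XT uX vX cX YW cY.
  have /card_gt0P[y yY] : 0 < #|Y| by apply: leq_ltn_trans cY.
  have yW := subsetP YW _ yY.
  have yu : y != u by apply/eqP => E; apply: (TW uT); rewrite -E.
  have yv : y != v by apply/eqP => E; apply: (TW vT); rewrite -E.
  exists (v |: (y |: [set u])); split.
  - apply: linked_step (eTW vT yW) _ _; first by rewrite !inE negb_or ![v == _]eq_sym yv.
    by apply: linked_step (linked_refl _ _); rewrite ?inE // e_sym eTW.
  - by rewrite !cardsU1 cards1 !inE negb_or yu ![v == _]eq_sym yv uv.
  - move=> z /setU1P[->|/set2P[->|->]]; [exact: Or44|exact: Or42|exact: Or43].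
have /card_gt0P[x xX] : 0 < #|X| by rewrite cX.
have /card_gt0P[y yY] : 0 < #|Y| by apply: leq_ltn_trans cY.
have yW := subsetP YW _ yY.
have xT := subsetP XT _ xX.
have [//|//||||||||R [hR cR sR]] := IH (X :\ x) (Y :\ y) x.
- by apply: contraNneq uX => ->.
- by apply: subset_trans XT; apply: subsetDl.
- by rewrite inE negb_and uX orbT.
- by rewrite !inE eqxx.
- by move: cX; rewrite (cardsD1 x) xX => -[].
- by apply: subset_trans YW; apply: subsetDl.
- by move: cY; rewrite (cardsD1 y) yY.
have yR : y \notin R.
  apply/negP => /sR[/setD1P[_ /(subsetP XT) h]|/setD1P[]|E|E].
  - exact: TW h yW.
  - by rewrite eqxx.
  - by apply: TW uT _; rewrite -E.
  - by apply: TW xT _; rewrite -E.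
have vyR : v \notin y |: R.
  rewrite in_setU1 negb_or; apply/andP; split.
    by apply/eqP => E; apply: (TW vT); rewrite E.
  apply/negP => /sR[/setD1P[_ h]|/setD1P[_ /(subsetP YW) /(TW vT)]|E|E] //.
  - by rewrite h in vX.
  - by rewrite E eqxx in uv.
  - by rewrite E xX in vX.
exists (v |: (y |: R)); split.
- apply: linked_step (eTW vT yW) vyR _.
  by apply: linked_step yR hR; rewrite e_sym eTW.
- by rewrite !cardsU1 vyR yR cR doubleS.
- move=> z /setU1P[->|/setU1P[->|/sR[]]]; first exact: Or44; first exact: Or42.
  + by case/setD1P => _; apply: Or41.
  + by case/setD1P => _; apply: Or42.
  + exact: Or43.
  + by move=> ->; apply: Or41.
Qed.

(** [W] is so large that [t - 1] of its vertices avoid [S]. A zigzag through these and all of [T]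
    has [2 * t - 1] vertices and closes the ear to a cycle with at least two more. *)
Lemma no_long_ear u v S : linked e u v S -> u \in T -> v \in T -> u != v ->
  (forall x, x \in S -> x \in T -> x = u \/ x = v) -> 3 < #|S| -> False.
Proof.
move=> hS uT vT uv d S3.
have Sc := linked_le hS.
have cX : #|T :\ u :\ v| = t - 2.
  have := cardsD1 u T; have := cardsD1 v (T :\ u).
  by rewrite !inE vT uT eq_sym uv; lia.
have cY : t - 2 < #|W :\: S|.
  by have := cardsID S W; have := subset_leq_card (subsetIr W S); lia.
have [||||R [hR cR sR]] := linked_zigzag vT uT uv _ _ _ cX _ cY.
- by apply: subset_trans (subsetDl _ _) (subsetDl _ _).
- by rewrite !inE eqxx andbF.
- by rewrite !inE eqxx.
- exact: subsetDl.
have dSR x : x \in S -> x \in R -> x = u \/ x = v.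
  move=> xS /sR[|/setDP[_]|->|->]; [|by rewrite xS|by left|by right].
  by case/setD1P=> _ /setD1P[_]; apply: d.
have le2 : #|S :&: R| <= 2.
  have : S :&: R \subset [set u; v].
    by apply/subsetP => x /setIP[xS /(dSR _ xS)] [->|->]; rewrite !inE eqxx ?orbT.
  by move/subset_leq_card; rewrite cards2 uv.
have := circumference_theta e_sym hc hS (linked_sym e_sym hR) uv dSR.
by have := cardsUI S R; lia.
Qed.

Lemma linked_short u v S : linked e u v S -> u != v -> #|S| <= 2 -> e u v.
Proof.
case=> [x|{}u z {}v R euz uR hR]; first by rewrite eqxx.
rewrite cardsU1 uR => _ cR.
have : #|R| <= 1 by lia.
move/card_le1P => /(_ _ (linked_l hR)) E.
by have := linked_r hR; rewrite E inE => /eqP ->.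
Qed.

Lemma linked_next u v S : linked e u v S -> u != v -> exists2 z, z \in S & e u z.
Proof.
case=> [x|{}u z {}v R euz _ hR _]; first by rewrite eqxx.
by exists z; rewrite // inE (linked_l hR) orbT.
Qed.

(** A path from [y] to [T] avoiding [s] ends at some [z]. One of [w], [v] differs from [z], and from
    it through [s] and [y] to [z] runs an ear with at least four vertices. *)
Lemma no_outer_fork s y w v : s \notin T -> y \notin T -> e s y ->
  w \in T -> v \in T -> w != v -> e s w -> e s v -> False.
Proof.
move=> sT yT esy wT vT wv esw esv.
have neT x z : x \in T -> z \notin T -> x != z by move=> xT; apply: contraNneq => <-.
have ys : y != s by apply: contraTneq esy => ->; rewrite e_irr.
have [|y' [z [R [/set1P-> zT hR sR [_ dR]]]]] :=
  link_avoiding e_sym hcut (set11 y) wT ys; first exact: neT.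
have fin q : q \in T -> q != z -> e s q -> False.
  move=> qT qz esq.
  have qR : q \notin s |: R.
    rewrite !inE negb_or neT //; apply/negP => /dR/(_ qT) E.
    by rewrite E eqxx in qz.
  have hL : linked e q z (q |: (s |: R)).
    by apply: linked_step qR _; [rewrite e_sym|apply: linked_step sR hR].
  apply: (no_long_ear hL qT zT qz).
    move=> x /setU1P[->|/setU1P[->|xR xT]]; [by left|by rewrite (negbTE sT)|].
    by right; apply: dR.
  rewrite !cardsU1 qR sR (cardsD1 y) (linked_l hR) (cardsD1 z).
  by rewrite !inE (linked_r hR) neT.
have [E|wz] := eqVneq w z; last exact: (fin w).
by apply: (fin v) => //; rewrite -E eq_sym.
Qed.

(** The edge is prolonged to a path from [x] through [y] to some [w] in [T], and a second path,
    avoiding [w], leaves it at [s] for another [v] in [T]. The ear from [w] through [s] to [v] must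
    be short, so [s] is adjacent to both, and its other neighbour on the first path gives a
    forbidden fork. *)
Lemma biclique_cover x y : x \notin T -> y \notin T -> e x y -> False.
Proof.
move=> xT yT exy.
have neT a b : a \in T -> b \notin T -> a != b by move=> aT; apply: contraNneq => <-.
have yx : y != x by apply: contraTneq exy => ->; rewrite e_irr.
have /card_gt0P[w0 w0T] : 0 < #|T| by lia.
have [|y' [w [S [/set1P-> {w0T}wT hS xS [_ dS]]]]] :=
  link_avoiding e_sym hcut (set11 y) w0T yx; first exact: neT.
have hP : linked e x w (x |: S) := linked_step exy xS hS.
have /card_gt0P[v0 v0T] : 0 < #|T :\ w| by have := cardsD1 w T; rewrite wT; lia.
have xP : x \in (x |: S) :\ w by rewrite !inE eqxx eq_sym neT.
have xw : x != w by rewrite eq_sym neT.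
have v0w : v0 != w by case/setD1P: v0T.
have [s [v [R [/setD1P[sw sP] /setD1P[vw vT] hR wR [d1 d2]]]]] :=
  link_avoiding e_sym hcut xP v0T xw v0w.
have PT q : q \in x |: S -> q \in T -> q = w.
  by case/setU1P=> [->|/dS//]; rewrite (negbTE xT).
have sT : s \notin T by apply: contra_neqN sw; apply: PT.
have [P1 [P2 [k1 k2 EP dP]]] := linked_split hP sP.
have sub1 q : q \in P1 -> q \in x |: S by rewrite EP inE => ->.
have sub2 q : q \in P2 -> q \in x |: S by rewrite EP inE orbC => ->.
have dPR q : q \in P2 -> q \in R -> q = s.
  move=> qP qR; apply: d1 => //; rewrite in_setD1 sub2 // andbT.
  by apply: contraNneq wR => <-.
have hL : linked e w v (P2 :|: R).
  by apply: linked_glue (linked_sym e_sym k2) hR dPR.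
have short : #|P2 :|: R| <= 3.
  rewrite leqNgt; apply/negP; apply: (no_long_ear hL) => //; first by rewrite eq_sym.
  move=> q /setUP[qP|qR] qT; first by left; apply: PT (sub2 _ qP) qT.
  right; apply: d2 => //; rewrite in_setD1 qT andbT.
  by apply: contraNneq wR => <-.
have sv : s != v by rewrite eq_sym neT.
have PR1 : #|P2 :&: R| <= 1.
  have : P2 :&: R \subset [set s].
    by apply/subsetP => q /setIP[qP qR]; rewrite inE (dPR q).
  by move/subset_leq_card; rewrite cards1.
have two a b A : linked e a b A -> a != b -> 1 < #|A|.
  move=> h ab; have : [set a; b] \subset A.
    by apply/subsetP => q /set2P[]->; rewrite ?(linked_l h) ?(linked_r h).
  by move/subset_leq_card; rewrite cards2 ab.
have := two _ _ _ k2 sw; have := two _ _ _ hR sv; have := cardsUI P2 R => cUI cR cP2.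
have [cP2' cR'] : #|P2| <= 2 /\ #|R| <= 2.
  move: cUI short PR1 cR cP2; move: #|P2| #|R| #|P2 :|: R| #|P2 :&: R|.
  by clear; lia.
have esw : e s w := linked_short k2 sw cP2'.
have esv : e s v := linked_short hR sv cR'.
have wv : w != v by rewrite eq_sym.
have [sx|sx] := eqVneq s x.
  by apply: (no_outer_fork sT yT _ wT vT wv esw esv); rewrite sx.
have [z zP1 esz] := linked_next (linked_sym e_sym k1) sx.
apply: (no_outer_fork sT _ esz wT vT wv esw esv).
apply/negP => zT; have zw := PT _ (sub1 _ zP1) zT.
have zs : z = s by apply: dP zP1 _; rewrite zw (linked_r k2).
by rewrite -zs zT in sT.
Qed.

End Biclique.

(** * Degeneracy and levels *)

Section Core.

Variables (V : finType) (e : rel V).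
Hypotheses (e_sym : symmetric e) (e_irr : irreflexive e).

Lemma linked_clique (S : {set V}) x : x \in S ->
  {in S &, forall y z, y != z -> e y z} ->
  exists2 y, y \in S & linked e x y S.
Proof.
have [n] := ubnP #|S|; elim: n S x => // n IH S x Sn xS cl.
have [S1|/set0Pn[y yS]] := eqVneq (S :\ x) set0.
  exists x => //; suff -> : S = [set x] by apply: linked_refl.
  by rewrite -(setD1K xS) S1 setU0.
have [||z zS hz] := IH _ _ _ yS.
- by move: Sn; rewrite (cardsD1 x) xS.
- by move=> a b /setD1P[_ aS] /setD1P[_ bS]; apply: cl.
exists z; first by case/setD1P: zS.
rewrite -(setD1K xS); apply: linked_step hz; last by rewrite !inE eqxx.
by case/setD1P: yS => yx yS; apply: cl; rewrite // eq_sym.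
Qed.

(* A longest path of more than [2t] vertices with ends in [S] contains all the
   [S]-neighbours of its ends, hence by [posa] closes up to a cycle of length
   at least [2t + 1]. *)
Lemma core_card t (S : {set V}) : 0 < t -> no_cut e -> circumference_le e (2 * t) ->
  (forall x y, x != y -> ~~ e x y -> exists2 R, linked e x y R & 2 * t < #|R|) ->
  (forall x, x \in S -> t < #|[set y in S | e x y]|) -> #|S| <= 2 * t.
Proof.
move=> t0 hcut hc hmax hS; rewrite leqNgt; apply/negP => cS.
pose Q (P : {set V}) := `[< exists x y,
  [/\ x \in S, y \in S, linked e x y P & 2 * t < #|P|] >].
(* A long path to start from: by edge-maximality if [S] has two non-adjacent vertices, and otherwise
   a path through the whole clique [S]. *)
have [P0 QP0] : exists P0, Q P0.
  have [[x [y [xS yS xy nxy]]]|cl] :=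
      EM (exists x y, [/\ x \in S, y \in S, x != y & ~~ e x y]).
    by have [R hR cR] := hmax _ _ xy nxy; exists R; apply/asboolP; exists x, y.
  have /card_gt0P[x xS] : 0 < #|S| by apply: leq_ltn_trans cS.
  have [|y yS hy] := linked_clique xS.
    move=> y z yS zS yz; apply: contrapT => nyz; apply: cl; exists y, z.
    by split=> //; apply/negP.
  by exists S; apply/asboolP; exists x, y.
case: (arg_maxnP (fun P : {set V} => #|P|) QP0) => P /asboolP[x [y [xS yS hP cP]]] Pmax.
have onP u w : u \in S -> w \in S -> linked e u w P ->
    forall z, z \in [set z in S | e u z] -> z \in P.
  move=> uS wS hu z; rewrite inE => /andP[zS uz]; apply: contraT => zP.
  have : Q (z |: P).
    apply/asboolP; exists z, w; split=> //.
      by apply: linked_step zP hu; rewrite e_sym.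
    by apply: leq_trans cP _; rewrite subset_leq_card // subsetUr.
  by move/Pmax; rewrite cardsU1 zP /= add1n ltnn.
have [v [hv v0 vl EP]] := linked_path hP.
have m2 : 2 < #|P| by apply: leq_ltn_trans cP; lia.
have := @posa V e e_sym e_irr v #|P| (2 * t)
  [set z in S | e x z] [set z in S | e y z] hcut hc hv m2.
have c1 := hS _ xS; have c2 := hS _ yS.
rewrite v0 vl -EP => hh.
suff : minn #|P| (t.+1 + t.+1) <= 2 * t by lia.
apply: leq_trans (hh _ _ _ _).
- by rewrite leq_min geq_minl (leq_trans (geq_minr _ _)) // leq_add.
- by move=> z zD; split; [move: zD; rewrite inE => /andP[]|apply: onP hP z zD].
- move=> z zD; split; first by move: zD; rewrite inE => /andP[].
  exact: onP (linked_sym e_sym hP) z zD.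
- by apply: leq_trans c1.
- by apply: leq_trans c2.
Qed.

Definition later (o : V -> nat) v := [set w | e v w && (o v < o w)].

(** Vertices with at most [t] remaining neighbours are removed one after another until at most [q]
    vertices are left; these come last, in any order, and are the only ones that may exceed [t]. *)
Lemma degenerate_order t q :
  (forall S : {set V}, q < #|S| ->
     exists2 x, x \in S & #|[set y in S | e x y]| <= t) -> t <= q ->
  exists o : V -> nat, [/\ injective o, forall v, #|later o v| <= q &
    #|[set v | t < #|later o v|]| <= q].
Proof.
move=> hdeg tq; pose out (S : {set V}) o v := [set w in S | e v w && (o v < o w)].
suff H n (S : {set V}) : #|S| <= n -> exists o : V -> nat,
    [/\ {in S &, injective o}, {in S, forall v, #|out S o v| <= q} &
    #|[set v in S | t < #|out S o v|]| <= q].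
  have [o [inj ho co]] := H _ [set: V] (leqnn _).
  have E v : out [set: V] o v = later o v by apply/setP=> w; rewrite !inE.
  exists o; split=> [x y|v|]; first by apply: inj.
    by rewrite -E; apply: ho.
  by apply: leq_trans co; apply: subset_leq_card; apply/subsetP=> v; rewrite !inE E.
elim: n S => [|n IH] S Sn.
  have S0 : S = set0 by apply/eqP; rewrite -cards_eq0; lia.
  exists (fun=> 0); rewrite S0; split=> [x y|x|]; rewrite ?inE //.
  by rewrite (_ : [set v in _ | _] = set0) ?cards0 //; apply/setP=> x; rewrite !inE.
have [Sq|Sq] := leqP #|S| q.
  have outS o v : #|out S o v| <= q.
    by apply: leq_trans Sq; apply: subset_leq_card; apply/subsetP=> w; rewrite inE => /andP[].
  exists (fun v => enum_rank v : nat); split=> // [x y _ _ /val_inj/enum_rank_inj|] //.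
  by apply: leq_trans Sq; apply: subset_leq_card; apply/subsetP=> w; rewrite inE => /andP[].
have [x xS dx] := hdeg _ Sq.
have [|o [inj ho co]] := IH (S :\ x); first by move: Sn; rewrite (cardsD1 x) xS.
pose o' v := if v == x then 0 else (o v).+1.
have outx : #|out S o' x| <= t.
  apply: leq_trans dx; apply: subset_leq_card; apply/subsetP=> w.
  by rewrite !inE => /and3P[-> ->].
have outE v : v != x -> out S o' v = out (S :\ x) o v.
  move=> vx; apply/setP=> w; rewrite !inE /o' (negbTE vx).
  by case: eqP => //= _; rewrite ltn0 !andbF.
exists o'; split.
- move=> u v uS vS; rewrite /o'; case: eqP => [->|/eqP ux]; case: eqP => [->|/eqP vx] //.
  by case=> /inj; rewrite !inE ux vx; apply.
- move=> v vS; have [->|vx] := eqVneq v x; first exact: leq_trans outx tq.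
  by rewrite outE //; apply: ho; rewrite !inE vx.
- apply: leq_trans co; apply: subset_leq_card; apply/subsetP=> v.
  rewrite inE => /andP[vS tv].
  have vx : v != x by apply: contraTneq tv => ->; rewrite -leqNgt.
  by rewrite !inE vx vS -outE.
Qed.

Definition edges_of (r : rel V) : {set {set V}} :=
  [set [set p.1; p.2] | p : V * V & r p.1 p.2].

Lemma edges_of_later o : injective o -> #|edges_of e| <= \sum_v #|later o v|.
Proof.
move=> inj; pose D := [set p : V * V | p.2 \in later o p.1].
have cD : #|D| = \sum_v #|later o v|.
  under [RHS]eq_bigr => v _ do rewrite -sum1_card.
  by rewrite pair_big_dep /= -sum1_card; apply: eq_bigl => p; rewrite inE.
rewrite -cD; apply: leq_trans (leq_imset_card (fun p => [set p.1; p.2]) D).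
apply: subset_leq_card; apply/subsetP => E /imsetP[[x y]]; rewrite inE /= => exy ->.
case: (ltngtP (o x) (o y)) => [xy|yx|/inj E'].
- by apply/imsetP; exists (x, y); rewrite ?inE /= ?exy.
- by apply/imsetP; exists (y, x); rewrite ?inE /= 1?e_sym ?exy //= setUC.
- by rewrite E' e_irr in exy.
Qed.

(* Vertices whose later neighbours all lie in a bounded set are grouped by
   these neighbours; as increasing paths are bounded, some group is large. *)
Lemma large_fibre (o : V -> nat) t L M c : 0 < M ->
  (forall u v S, linked e u v S -> #|S| <= L) ->
  #|[set v | #|later o v| != t]| <= c ->
  iter L (fun b => b + M * 2 ^ b) c < #|V| ->
  exists2 T : {set V}, #|T| = t & M <= #|[set v | later o v == T]|.
Proof.
move=> M0 hL hc hV; apply: contrapT => nT.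
have fib (T : {set V}) : #|T| = t -> #|[set v | later o v == T]| <= M.
  by move=> cT; rewrite leqNgt; apply/negP => h; apply: nT; exists T => //; apply: ltnW.
set N0 := [set v | _] in hc.
(* A level adds the vertices whose [t] later neighbours were all reached before. There are at most
   [M] for each subset of [N], which gives the recursion [b + M * 2 ^ b]. *)
pose next (N : {set V}) := N :|: [set v | (v \notin N0) && (later o v \subset N)].
pose N i := iter i next N0.
have N0N i : N0 \subset N i.
  by elim: i => // i IH; apply: subset_trans IH (subsetUl _ _).
have cnext (A : {set V}) : #|next A| <= #|A| + M * 2 ^ #|A|.
  apply: leq_trans (leq_card_setU _ _) _; rewrite leq_add2l.
  rewrite -sum1_card (partition_big (later o) (mem (powerset A))) /=; last first.
    by move=> v; rewrite !inE => /andP[].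
  rewrite -card_powerset mulnC -sum_nat_const; apply: leq_sum => T _.
  rewrite sum1_card; have [cT|cT] := eqVneq #|T| t.
    apply: leq_trans (fib _ cT); apply: subset_leq_card; apply/subsetP => v.
    by rewrite !inE => /andP[_].
  rewrite eq_card0 // => v; apply/negP => /andP[].
  by rewrite inE => /andP[vN _] /eqP E; rewrite inE E cT in vN.
have cN i : #|N i| <= iter i (fun b => b + M * 2 ^ b) c.
  elim: i => //= i IH; apply: leq_trans (cnext _) _.
  by apply: leq_add => //; rewrite leq_mul2l leq_exp2l // IH orbT.
(* A vertex missed by level [i] has a later neighbour missed by the level before; iterating this
   gives an increasing path with [i.+1] vertices, so level [L] misses nothing. *)
have path i v : v \notin N i ->
    exists u S, [/\ linked e v u S, #|S| = i.+1 & {in S, forall z, o v <= o z}].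
  elim: i v => [|i IH] v vN.
    exists v, [set v]; rewrite cards1; split=> //; first exact: linked_refl.
    by move=> z /set1P->.
  have : v \notin next (N i) by [].
  rewrite !inE negb_or => /andP[_]; rewrite negb_and negbK.
  have -> /= : #|later o v| != t = false.
    by apply: contraNF vN => h; apply: (subsetP (N0N _)); rewrite inE.
  case/subsetPn => w; rewrite inE => /andP[evw ovw] /IH[u [S [hS cS oS]]].
  have vS : v \notin S by apply/negP => /oS; rewrite leqNgt ovw.
  exists u, (v |: S); rewrite cardsU1 vS cS; split=> //.
    exact: linked_step evw vS hS.
  by move=> z /setU1P[->//|/oS]; apply: leq_trans; apply: ltnW.
have : N L != [set: V].
  by apply: contraTneq hV => E; rewrite -leqNgt -cardsT -E.
rewrite eqEsubset subsetT /= => /subsetPn[v _ /path[u [S [hS cS _]]]].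
by have := hL _ _ _ hS; rewrite cS ltnn.
Qed.

End Core.

(** * Covering all edges by t vertices *)

Section AddEdge.

Variables (V : finType) (e : rel V) (x y : V).
Hypothesis (e_sym : symmetric e).

Definition add_edge : rel V :=
  fun a b => [|| e a b, (a == x) && (b == y) | (a == y) && (b == x)].

(** A path uses the new edge at most once, and removing it leaves two disjoint paths. *)
Lemma linked_add_edge a b S : linked add_edge a b S -> linked e a b S \/
  exists S1 S2, [/\ S = S1 :|: S2, forall z, z \in S1 -> z \in S2 -> False &
    linked e a x S1 /\ linked e y b S2 \/ linked e a y S1 /\ linked e x b S2].
Proof.
elim=> {a b S} [a|a c b S eac aS _ IH]; first by left; apply: linked_refl.
have dis z : z \in [set a] -> z \in S -> False.
  by move=> /set1P-> h; rewrite h in aS.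
case: IH => [h|[S1 [S2 [ES d h]]]].
  case/or3P: eac => [eac|/andP[/eqP Ea /eqP Ec]|/andP[/eqP Ea /eqP Ec]].
  - by left; apply: linked_step eac aS h.
  - right; exists [set a], S; split=> //.
    by left; rewrite -Ea -Ec; split=> //; apply: linked_refl.
  - right; exists [set a], S; split=> //.
    by right; rewrite -Ea -Ec; split=> //; apply: linked_refl.
move: aS; rewrite ES inE negb_or => /andP[a1 a2].
case/or3P: eac => [eac|/andP[/eqP Ea /eqP Ec]|/andP[/eqP Ea /eqP Ec]].
- right; exists (a |: S1), S2; split; first by rewrite setUA.
    by move=> z /setU1P[->|]; [apply/negP|apply: d].
  by case: h => -[h1 h2]; [left|right]; split=> //; apply: linked_step eac a1 h1.
- case: h => -[h1 h2].
    by case: (d y); [rewrite -Ec (linked_l h1)|apply: linked_l h2].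
  by move: a2; rewrite Ea (linked_l h2).
- case: h => -[h1 h2]; first by move: a2; rewrite Ea (linked_l h2).
  by case: (d x); [rewrite -Ec (linked_l h1)|apply: linked_l h2].
Qed.

(** A cycle through the new edge is an old path from [x] to [y] closed by that edge. *)
Lemma circumference_add_edge c : circumference_le e c ->
  (forall R, linked e x y R -> #|R| <= c) -> circumference_le add_edge c.
Proof.
move=> hc hR u v S hS evu S2.
case: (linked_add_edge hS) => [h|[S1 [S2' [ES d h]]]].
  case/or3P: evu => [evu|/andP[/eqP Ev /eqP Eu]|/andP[/eqP Ev /eqP Eu]].
  - exact: hc h evu S2.
  - by apply: hR; apply: (linked_sym e_sym); rewrite -Ev -Eu.
  - by apply: hR; rewrite -Ev -Eu.
have dis z : z \in S2' -> z \in S1 -> False by move=> h2 h1; apply: d h1 h2.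
case/or3P: evu => [evu|/andP[/eqP Ev /eqP Eu]|/andP[/eqP Ev /eqP Eu]].
- rewrite ES setUC; case: h => -[h1 h2].
    apply/hR/(linked_sym e_sym); exact: linked_join h2 evu h1 dis.
  by apply: hR; apply: linked_join h2 evu h1 dis.
(* The new edge would be both the closing edge and an edge of the path, which leaves only two
   vertices. *)
- case: h => -[h1 h2].
    by case: (d x); [apply: linked_r h1|rewrite -Ev (linked_r h2)].
  move: S2 h1 h2; rewrite ES Ev Eu => S2 /linked_loop E1 /linked_loop E2.
  by move: S2; rewrite E1 E2 cards2; case: eqP.
- case: h => -[h1 h2]; last first.
    by case: (d y); [apply: linked_r h1|rewrite -Ev (linked_r h2)].
  move: S2 h1 h2; rewrite ES Ev Eu => S2 /linked_loop E1 /linked_loop E2.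
  by move: S2; rewrite E1 E2 cards2; case: eqP.
Qed.

Lemma linked_mono (e' : rel V) a b S : subrel e e' -> linked e a b S ->
  linked e' a b S.
Proof.
move=> sub; elim=> {a b S} [a|a c b S eac aS _ IH]; first exact: linked_refl.
exact: linked_step (sub _ _ eac) aS IH.
Qed.

End AddEdge.

(** [L] bounds the number of vertices of a path, by [linked_card] with [c = 2 * t], and [L + t] is
    the size of the biclique needed. The recursion of [large_fibre] starts from a bound on the
    vertices without exactly [t] later neighbours: at most [2 * t] have more, and at most
    [5 * t * t] have fewer. *)
Definition cover_bound t :=
  let L := 2 * t * (2 * t) in
  iter L (fun b => b + (L + t) * 2 ^ b) (2 * t + 5 * t * t).

Lemma cover_edge_maximal t (V : finType) (e : rel V) : 1 < t ->
  symmetric e -> irreflexive e -> no_cut e -> circumference_le e (2 * t) ->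
  (forall x y, x != y -> ~~ e x y -> exists2 R, linked e x y R & 2 * t < #|R|) ->
  cover_bound t < #|V| -> t * (#|V| - t) <= #|edges_of e| ->
  exists2 T : {set V}, #|T| = t & forall x y, x \notin T -> y \notin T -> ~~ e x y.
Proof.
move=> t1 e_sym e_irr hcut hc hmax hV hE.
have t0 : 0 < t by lia.
have [|| o [inj ho co]] := @degenerate_order V e t (2 * t).
- move=> S cS; apply: contrapT => nS; move: cS; rewrite ltnNge => /negP; apply.
  apply: (core_card e_sym e_irr t0 hcut hc hmax) => x xS.
  by rewrite ltnNge; apply/negP => h; apply: nS; exists x.
- by lia.
have hL u v S : linked e u v S -> #|S| <= 2 * t * (2 * t).
  by apply: linked_card => //; lia.
have M0 : 0 < 2 * t * (2 * t) + t by lia.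
have [|T cT cW] := large_fibre (o := o) (t := t) M0 hL _ hV.
  have := leq_trans hE (edges_of_later e_sym e_irr inj).
  set Z := [set v | t < _] in co; pose D := [set v | #|later e o v| < t].
  move=> hsum.
  (* Vertices of [D] fall short of [t] by at least one, and only those of [Z] exceed it. With at
     least [t * (#|V| - t)] edges this leaves [t * t + 4 * t * t] for [#|D|]. *)
  have sumD : \sum_v #|later e o v| + #|D| <= t * #|V| + #|Z| * (2 * t).
    have -> : t * #|V| = \sum_(v : V) t by rewrite sum_nat_const mulnC.
    rewrite -[#|D|]sum1_card [X in _ + X <= _]big_mkcond -big_split /=.
    rewrite -[#|Z|]sum1_card big_distrl /= [X in _ <= _ + X]big_mkcond -big_split /=.
    apply: leq_sum => v _; rewrite !inE; have := ho v.
    by case: ltngtP; lia.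
  have : #|[set v | #|later e o v| != t]| <= #|Z| + #|D|.
    apply: leq_trans (leq_card_setU _ _); apply: subset_leq_card.
    by apply/subsetP => v; rewrite !inE neq_ltn orbC.
  move=> cN; apply: leq_trans cN _.
  have : #|Z| * (2 * t) <= 2 * t * (2 * t) by rewrite leq_mul2r co orbT.
  move: hsum sumD co; rewrite mulnBr.
  move: (\sum_v _) (t * #|V|) (#|D|) (#|Z|) => a b d z; clear; lia.
pose W := [set v | later e o v == T].
exists T => // x y xT yT; apply/negP => exy.
apply: (biclique_cover e_sym e_irr t1 hcut hc hL cT cW _ xT yT exy).
by move=> u w uT; rewrite inE => /eqP E; move: uT; rewrite -E inE e_sym => /andP[].
Qed.

(** Edges are added while the circumference permits, by induction on the number of non-adjacent
    pairs; a set that covers the edges of the larger graph covers those of [e]. *)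
Lemma exists_cover t (V : finType) (e : rel V) : 1 < t ->
  symmetric e -> irreflexive e -> no_cut e -> circumference_le e (2 * t) ->
  cover_bound t < #|V| -> t * (#|V| - t) <= #|edges_of e| ->
  exists2 T : {set V}, #|T| = t & forall x y, x \notin T -> y \notin T -> ~~ e x y.
Proof.
move=> t1; have [n] := ubnP #|[set p : V * V | ~~ e p.1 p.2]|.
elim: n e => // n IH e cn e_sym e_irr hcut hc hV hE.
have [[x [y [xy nxy hR]]]|hmax] := EM (exists x y,
    [/\ x != y, ~~ e x y & forall R, linked e x y R -> #|R| <= 2 * t]); last first.
  apply: cover_edge_maximal => // x y xy nxy; apply: contrapT => nR.
  apply: hmax; exists x, y; split=> // R hR; rewrite leqNgt; apply/negP => cR.
  by apply: nR; exists R.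
have sub : subrel e (add_edge e x y) by move=> a b; rewrite /add_edge => ->.
have [|||||//||T cT hT] := IH (add_edge e x y).
- rewrite ltnS in cn; apply: leq_trans cn; apply: proper_card; apply/properP; split.
    by apply/subsetP => p; rewrite !inE; apply: contra => /sub.
  by exists (x, y); rewrite !inE //= /add_edge !eqxx orbT.
- move=> a b; rewrite /add_edge e_sym orbC -orbA.
  by do 4![case: eqP => _]; rewrite ?orbT ?orbF ?andbT ?andbF.
- move=> a; rewrite /add_edge e_irr /=; case: eqP => [->|_] /=.
    by rewrite (negbTE xy).
  by rewrite andbF.
- move=> c a b ac bc; have [S hS cS] := hcut c a b ac bc.
  by exists S => //; apply: linked_mono hS.
- exact: circumference_add_edge.
- apply: leq_trans hE _; apply: subset_leq_card; apply/subsetP => E.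
  case/imsetP => p; rewrite inE => /sub ep ->.
  by apply/imsetP; exists p; rewrite ?inE.
- by exists T => // a b aT bT; apply: contra (hT a b aT bT) => /sub.
Qed.

(** * Graphs as relations *)

Lemma linked_seqP (V : finType) (e : rel V) u v S : linked e u v S ->
  exists p, [/\ path e u p, last u p = v, uniq (u :: p) & S = [set z in u :: p]].
Proof.
elim=> {u v S} [u|u v w S euv uS _ [p [hp lp up ES]]].
  by exists [::]; split=> //; apply/setP => z; rewrite !inE.
exists (v :: p); split; rewrite /= ?euv //.
  by move: uS; rewrite ES inE => ->.
by apply/setP => z; rewrite ES !inE.
Qed.

Lemma linked_seq (V : finType) (e : rel V) u p : path e u p -> uniq (u :: p) ->
  linked e u (last u p) [set z in u :: p].
Proof.
elim: p u => [|v p IH] u /=.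
  by move=> _ _; rewrite (_ : [set z in _] = [set u]);
     [exact: linked_refl|apply/setP => z; rewrite !inE].
case/andP=> euv hp /andP[up vp].
rewrite (_ : [set z in _] = u |: [set z in v :: p]); last first.
  by apply/setP => z; rewrite !inE.
by apply: linked_step euv _ (IH _ hp vp); rewrite inE.
Qed.

Lemma linked_imset (V U : finType) (r : rel V) (e : rel U) (f : V -> U) a b S :
  injective f -> (forall x y, r x y -> e (f x) (f y)) ->
  linked r a b S -> linked e (f a) (f b) (f @: S).
Proof.
move=> inj hom; elim=> {a b S} [a|a b c S rab aS _ IH].
  by rewrite imset_set1; apply: linked_refl.
rewrite imsetU1; apply: linked_step (hom _ _ rab) _ IH.
by rewrite mem_imset.
Qed.

Section Graphs.

Variable G : graph.

Lemma edge_card (E : {set vertex G}) : E \in edge_set G -> #|E| = 2.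
Proof.
move=> EG; apply/eqP; have := valP (graph_str G).
by move/forall_inP; apply.
Qed.

Lemma adj_sym : symmetric (@adj G).
Proof. by move=> x y; rewrite /adj setUC. Qed.

Lemma adj_irr : irreflexive (@adj G).
Proof.
by move=> x; apply/negP => /edge_card; rewrite setUid cards1.
Qed.

Lemma edgeP (E : {set vertex G}) : E \in edge_set G ->
  exists x y, E = [set x; y] /\ adj x y.
Proof.
move=> EG; have /eqP/cards2P[x [y [_ Exy]]] := edge_card EG.
by exists x, y; split=> //; rewrite /adj -Exy.
Qed.

Lemma edge_set_adj : edge_set G = edges_of (@adj G).
Proof.
apply/setP => E; apply/idP/imsetP => [/edgeP[x [y [-> xy]]]|[[x y]]].
  by exists (x, y); rewrite ?inE.
by rewrite inE /= => h ->.
Qed.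

Lemma adj_induced (S : {set vertex G}) (x y : vertex (induced S)) :
  adj x y = adj (val x) (val y).
Proof. by rewrite /adj /edge_set /= inE imsetU1 imset_set1. Qed.

Lemma two_connected_no_cut : two_connected G -> no_cut (@adj G).
Proof.
move=> [_ h] c x y xc yc.
have [|_ con] := h [set c]; first by rewrite cards1.
have xS : x \in ~: [set c] by rewrite !inE.
have yS : y \in ~: [set c] by rewrite !inE.
have /connectP[p hp Ey] :=
  con (exist _ x xS : vertex (induced (~: [set c]))) (exist _ y yS).
case/shortenP: hp Ey => q hq uq _ Ey.
have := linked_imset val_inj _ (linked_seq hq uq); rewrite -Ey => /(_ (@adj G)) L.
exists (val @: [set z in (exist _ x xS : vertex (induced (~: [set c]))) :: q]).
  by apply: L => a b; rewrite adj_induced.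
by apply/imsetP => -[[z zS] _ /= E]; rewrite -E !inE eqxx in zS.
Qed.

(** A member of [cycles_ge] is a graph with no vertices besides its cycle, so a long cycle is
    rebuilt as a graph on the type of its own vertices and embedded by [val]. *)
Lemma free_circumference c : 1 < c -> free (cycles_ge c.+1) G ->
  circumference_le (@adj G) c.
Proof.
move=> c1 hfree u v S hS avu S2; rewrite leqNgt; apply/negP => cS.
have [p [hp lp up ES]] := linked_seqP hS.
set s := u :: p in up ES.
have cyc : cycle (@adj G) s by rewrite /s /= rcons_path hp lp.
pose s' : seq {x | x \in s} := pmap insub s.
have Es : map val s' = s.
  rewrite pmap_filter; last exact: insubK.
  by apply/all_filterP/allP => x xs; rewrite insubT.
have us' : uniq s' by rewrite -(map_inj_uniq val_inj) Es.
have ms' x : x \in s' by rewrite -(mem_map val_inj) Es (valP x).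
pose H := [set [set x; next s' x] | x in [set: {x | x \in s}]].
have hH (E : {set {x | x \in s}}) : E \in H -> val @: E \in edge_set G.
  case/imsetP => x _ ->; rewrite imsetU1 imset_set1 /=.
  rewrite -(next_map val_inj us') Es.
  exact: next_cycle cyc (valP x).
have H2 : [forall E in H, #|E| == 2].
  by apply/forall_inP => E /hH/edge_card; rewrite (card_imset _ val_inj) => ->.
have sS : size s = #|S| by rewrite ES cardsE; apply/esym/card_uniqP.
apply: (hfree (Graph (GraphOn H2))); last first.
  by exists val; split; [exact: val_inj|exact: hH].
exists #|S| => //; split=> //; exists s'; split=> //.
by rewrite -sS -(congr1 size Es) size_map.
Qed.

End Graphs.

(** * The lower bound *)

Section Join.

Variables (t n : nat) (tn : t <= n) (Q : graph_on 'I_t).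

(** The join of [Q], placed on the first [t] vertices, with [n - t] independent vertices. *)
Definition join_edges : {set {set 'I_n}} :=
  [set widen_ord tn @: E | E : {set 'I_t} in edges Q] :|:
  [set [set p.1; p.2] | p : 'I_n * 'I_n & (p.1 < t) && (t <= p.2)].

Let widen_inj : injective (widen_ord tn).
Proof. by move=> x y /(congr1 val) /= E; apply: val_inj. Qed.

Lemma join_card2 : [forall E in join_edges, #|E| == 2].
Proof.
apply/forall_inP => E /setUP[/imsetP[E' E'Q ->]|/imsetP[[x y]]].
  rewrite card_imset //.
  by have /forall_inP := valP Q; apply.
rewrite inE /= => /andP[xt ty] ->.
by rewrite cards2; case: (eqVneq x y) => // xy; move: ty; rewrite -xy; lia.
Qed.

Definition join_graph : graph_on 'I_n := GraphOn join_card2.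

Lemma join_adj_cross (x y : 'I_n) : x < t -> t <= y -> @adj (Graph join_graph) x y.
Proof.
move=> xt ty; rewrite /adj /edge_set /= in_setU; apply/orP; right.
by apply/imsetP; exists (x, y); rewrite ?inE ?xt.
Qed.

Lemma join_adj_indep (x y : 'I_n) : t <= x -> t <= y ->
  ~~ @adj (Graph join_graph) x y.
Proof.
move=> tx ty; rewrite /adj /edge_set /= in_setU negb_or; apply/andP; split.
  apply/imsetP => -[E _ /setP/(_ x)]; rewrite !inE eqxx => /esym/imsetP[z _ Ez].
  by have := ltn_ord z; have := congr1 val Ez; move=> /=; lia.
apply/imsetP => -[[u w]]; rewrite inE /= => /andP[ut _] /setP/(_ u).
by rewrite !inE eqxx /= => /orP[] /eqP Eu; rewrite Eu in ut; lia.
Qed.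

Lemma join_edges_card : #|edges join_graph| = #|edges Q| + t * (n - t).
Proof.
rewrite /= cardsU (_ : _ :&: _ = set0) ?cards0 ?subn0; last first.
  apply/setP => E; rewrite !inE; apply/negP => /andP[/imsetP[E' _ ->]].
  case/imsetP => -[u w]; rewrite inE /= => /andP[_ tw] /setP/(_ w).
  rewrite !inE eqxx orbT => /imsetP[z _ Ez].
  by have := ltn_ord z; have := congr1 val Ez; move=> /=; lia.
rewrite card_imset; last exact: imset_inj.
congr (_ + _).
rewrite card_in_imset; last first.
  move=> [u w] [u' w']; rewrite !inE /= => /andP[ut tw] /andP[ut' tw'] E.
  have : u \in [set u'; w'] by rewrite -E !inE eqxx.
  have : w \in [set u'; w'] by rewrite -E !inE eqxx orbT.
  rewrite !inE => /orP[] /eqP Ew /orP[] /eqP Eu.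
  - by rewrite Ew in tw; lia.
  - by rewrite Ew in tw; lia.
  - by rewrite Eu Ew.
  - by rewrite Eu in ut; lia.
have -> : [set p : 'I_n * 'I_n | (p.1 < t) && (t <= p.2)] =
    setX [set x : 'I_n | x < t] (~: [set x : 'I_n | x < t]).
  by apply/setP => -[x y]; rewrite !inE /= -leqNgt.
have ct : #|[set x : 'I_n | x < t]| = t.
  rewrite (_ : [set x | _] = widen_ord tn @: [set: 'I_t]).
    by rewrite card_imset // cardsT card_ord.
  apply/setP => x; rewrite inE; apply/idP/imsetP => [xt|[z _ ->]]; last exact: (ltn_ord z).
  by exists (Ordinal xt) => //; apply: val_inj.
by rewrite cardsX ct cardsCs setCK ct card_ord.
Qed.

(** Both sides have at least two vertices, so after a deletion some [a] and [b] survive on either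
    side, and every vertex reaches [a] directly or through [b]. *)
Lemma join_two_connected : 1 < t -> t.+1 < n -> two_connected (Graph join_graph).
Proof.
move=> t1 tn1; split=> [|X X1]; first by rewrite /= card_ord; lia.
pose A := [set x : 'I_n | x < t].
have pick (a b : 'I_n) : a != b -> a \notin X \/ b \notin X.
  move=> ab; have [aX|] := boolP (a \in X); last by left.
  right; apply/negP => bX; have : [set a; b] \subset X.
    by apply/subsetP => z /set2P[]->.
  by move/subset_leq_card; rewrite cards2 ab leqNgt => /negP; apply.
have n0 : 0 < n by lia.
have n1 : 1 < n by lia.
have tn' : t < n by lia.
have [a aX at'] : exists2 a : 'I_n, a \in ~: X & a < t.
  case: (pick (Ordinal n0) (Ordinal n1)) => // h; [exists (Ordinal n0)|exists (Ordinal n1)];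
  by rewrite ?inE //=; lia.
have [b bX tb] : exists2 b : 'I_n, b \in ~: X & t <= b.
  case: (pick (Ordinal tn') (Ordinal tn1)) => [|h|h].
  - by apply/eqP => /(congr1 val) /=; lia.
  - by exists (Ordinal tn'); rewrite ?inE.
  - by exists (Ordinal tn1); rewrite ?inE //=; lia.
split; first by apply/card_gt0P; exists (exist _ a aX).
pose GX := induced (~: X : {set vertex (Graph join_graph)}).
pose r := @adj GX.
have rs : symmetric r by apply: adj_sym.
have rc (x y : vertex GX) : val x < t -> t <= val y -> r x y.
  by move=> xt ty; rewrite /r adj_induced; apply: join_adj_cross.
pose a' : vertex GX := exist _ a aX.
pose b' : vertex GX := exist _ b bX.
have toa (x : vertex GX) : connect r x a'.
  have [xt|tx] := ltnP (val x) t; last by apply: connect1; rewrite rs rc.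
  apply: connect_trans (connect1 (rc x b' xt tb)) _.
  by apply: connect1; rewrite rs rc.
move=> x y; apply: connect_trans (toa x) _.
by rewrite (sym_connect_sym rs).
Qed.

Lemma join_free_cycles k : t.*2 < k -> free (cycles_ge k) (Graph join_graph).
Proof.
move=> tk H [l kl [_ [s [sl us ms EH]]]] [f [finj fE]].
have cl : #|vertex H| = l.
  by rewrite -sl -(card_uniqP us); apply: eq_card => x; rewrite ms.
pose A := [set x | f x < t].
have cA : #|A| <= t.
  rewrite -[t in _ <= t]card_ord -(card_in_imset (f := f)) => [|x y _ _ /finj//].
  rewrite -(card_imset predT widen_inj); apply: subset_leq_card.
  apply/subsetP => z /imsetP[x]; rewrite inE => xt ->.
  by apply/imsetP; exists (Ordinal xt) => //; apply: val_inj.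
(* The successor on the cycle maps the vertices on the independent side injectively into [A]. *)
have cB : #|~: A| <= #|A|.
  rewrite -(card_imset (~: A) (can_inj (prev_next us))).
  apply: subset_leq_card; apply/subsetP => z /imsetP[x].
  rewrite !inE -leqNgt => tx ->; rewrite ltnNge; apply/negP => tx'.
  have : [set x; next s x] \in edge_set H by rewrite EH; apply/imsetP; exists x.
  move/fE; rewrite imsetU1 imset_set1; apply/negP.
  exact: (join_adj_indep tx tx').
have := cardsC A; rewrite cl; lia.
Qed.

(** In a copy of [F], the vertices placed among the first [t] form a vertex covering, as all others
    are independent, and the part of [F] on them lies in [Q]. *)
Lemma join_free_graph F : free (covering_family F) (Graph Q) ->
  ~ contains (Graph join_graph) F.
Proof.
move=> hQ [f [finj fE]].
pose S := [set x | f x < t].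
apply: (hQ (induced S)).
  exists S => // x y; rewrite !inE -!leqNgt => tx ty.
  apply/negP => /fE; rewrite imsetU1 imset_set1; apply/negP.
  exact: (join_adj_indep tx ty).
have fS (x : {x | x \in S}) : f (val x) < t by have := valP x; rewrite inE.
pose h (x : {x | x \in S}) : 'I_t := Ordinal (fS x).
have hf x : widen_ord tn (h x) = f (val x) by apply: val_inj.
exists h; split=> [x y /(congr1 (widen_ord tn))|E].
  by rewrite !hf => /finj/val_inj.
rewrite /edge_set /= inE => /fE; rewrite /edge_set /= => /setUP[].
  case/imsetP => E' E'Q.
  have -> : f @: (val @: E) = widen_ord tn @: (h @: E).
    by rewrite -!imset_comp; apply: eq_imset => x /=; rewrite hf.
  by move/(imset_inj widen_inj) => ->.
case/imsetP => -[u w]; rewrite inE /= => /andP[_ tw] /setP/(_ w).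
rewrite !inE eqxx orbT => /imsetP[_ /imsetP[x xE ->] Ew].
by have := fS x; rewrite -Ew; lia.
Qed.

End Join.

Lemma big_minn_le (I : eqType) (r : seq I) (P : pred I) (g : I -> nat) d i :
  i \in r -> P i -> \big[minn/d]_(j <- r | P j) g j <= g i.
Proof.
elim: r => // j r IH; rewrite inE big_cons => /orP[/eqP<- ->|ir Pi].
  exact: geq_minl.
by case: ifP => _; rewrite ?geq_min IH ?orbT.
Qed.

Definition empty_graph t : graph_on 'I_t.
Proof. by exists set0; apply/forall_inP => E; rewrite inE. Defined.

(** A covering [S] with [F[S]] in an edgeless graph on [t] vertices is itself independent, so it is
    a colour class with at most [t] vertices. This ensures that [ex_num] is a maximum over a
    non-empty class. *)
Lemma empty_graph_free t F : le_inf (t + 1) (small_class F) ->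
  free (covering_family F) (Graph (empty_graph t)).
Proof.
move=> hF _ [S covS ->] [f [finj fE]].
have cS : #|S| <= t.
  rewrite -[t in _ <= t]card_ord -card_sig.
  by rewrite -(card_imset predT finj); apply: max_card.
have indS x y : x \in S -> y \in S -> ~~ adj x y.
  move=> xS yS; apply/negP => xy.
  have /fE : [set exist _ x xS; exist _ y yS] \in edge_set (induced S).
    by rewrite /edge_set /= inE imsetU1 imset_set1.
  by rewrite /edge_set /= inE.
pose c := [ffun x => x \in S].
have cp : proper2 c.
  apply/forallP => x; apply/forallP => y; apply/implyP => xy; rewrite !ffunE.
  case: (boolP (x \in S)) (boolP (y \in S)) => xS [] yS //.
    by have := indS _ _ xS yS; rewrite xy.
  by have := covS x y; rewrite !inE xS yS xy; move=> /(_ isT isT).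
have bip : bipartite F by apply/existsP; exists c.
move: hF; rewrite /small_class bip /=.
apply/negP; rewrite -ltnNge addn1 ltnS.
apply: leq_trans (big_minn_le _ _ (mem_index_enum c) cp) _.
apply: leq_trans (big_minn_le (P := predT) _ _ (mem_index_enum true) isT) _.
apply: leq_trans cS; apply: subset_leq_card.
by apply/subsetP => x; rewrite inE ffunE => /eqP.
Qed.

(** * The upper bound *)

Section Pullback.

Variables (G : graph) (U : finType) (g : U -> vertex G).
Hypothesis g_inj : injective g.

(** The subgraph induced on the image of [g], carried over to [U]; for [U = 'I_t] it is a competitor
    in [ex_num t]. *)
Definition pull_edges : {set {set U}} :=
  [set E : {set U} | g @: E \in edge_set G].

Lemma pull_card2 : [forall E in pull_edges, #|E| == 2].
Proof.
by apply/forall_inP => E; rewrite inE => /edge_card; rewrite (card_imset _ g_inj) => ->.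
Qed.

Definition pull : graph_on U := GraphOn pull_card2.

(** The vertices outside the covering [S] are independent, so they may go to any distinct vertices
    of [W], all of which are joined to the whole image of [g]. *)
Lemma extend_embedding (F : graph) (S : {set vertex F}) (W : {set vertex G}) :
  vertex_covering S -> contains (Graph pull) (induced S) ->
  #|vertex F| <= #|W| ->
  (forall u w, w \in W -> adj (g u) w /\ g u != w) -> contains G F.
Proof.
move=> covS [h [hinj hE]] FW gW.
pose psi (x : vertex F) := enum_val (widen_ord FW (enum_rank x)).
have psiW x : psi x \in W by apply: enum_valP.
have psi_inj : injective psi.
  move=> x y /enum_val_inj/(congr1 val) /= E.
  by apply: enum_rank_inj; apply: val_inj.
pose f x := if insub x is Some s then g (h s) else psi x.
have fS x (xS : x \in S) : f x = g (h (exist _ x xS)).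
  by rewrite /f insubT.
have fN x : x \notin S -> f x = psi x by move=> xS; rewrite /f insubN.
exists f; split.
  move=> x y; have [xS|xS] := boolP (x \in S); have [yS|yS] := boolP (y \in S).
  - by rewrite !fS => /g_inj/hinj/(congr1 val).
  - by rewrite fS fN // => E; have [_] := gW (h (exist _ x xS)) _ (psiW y); rewrite E eqxx.
  - by rewrite fN // fS => E; have [_] := gW (h (exist _ y yS)) _ (psiW x); rewrite E eqxx.
  - by rewrite !fN // => /psi_inj.
move=> E /edgeP[x [y [-> xy]]]; rewrite imsetU1 imset_set1.
have [xS|xS] := boolP (x \in S); have [yS|yS] := boolP (y \in S).
- rewrite !fS.
  have /hE : [set exist _ x xS; exist _ y yS] \in edge_set (induced S).
    by rewrite /edge_set /= inE imsetU1 imset_set1.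
  by rewrite /edge_set /= inE !imsetU1 !imset_set1.
- by rewrite fS fN //; have [] := gW (h (exist _ x xS)) _ (psiW y).
- by rewrite fN // fS setUC; have [] := gW (h (exist _ y yS)) _ (psiW x).
- by have := covS x y; rewrite !inE xS yS xy => /(_ isT isT).
Qed.

End Pullback.

Lemma ex_num_attained t Hs : (exists Q : graph_on 'I_t, free Hs (Graph Q)) ->
  exists2 Q : graph_on 'I_t, free Hs (Graph Q) & #|edges Q| = ex_num t Hs.
Proof.
case=> Q0 hQ0; pose P (Q : graph_on 'I_t) := `[< free Hs (Graph Q) >].
have P0 : P Q0 by apply/asboolP.
rewrite /ex_num (bigmax_eq_arg Q0 (P := P)) //.
by case: arg_maxnP => // Q /asboolP hQ _; exists Q.
Qed.

Lemma card_edges_cover (G : graph) t (g : 'I_t -> vertex G) (g_inj : injective g)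
    (T : {set vertex G}) : T = g @: [set: 'I_t] ->
  (forall x y, x \notin T -> y \notin T -> ~~ adj x y) ->
  #|edge_set G| <= #|pull_edges g| +
    #|[set p in setX T (~: T) | adj p.1 p.2]|.
Proof.
move=> ET hT; set P := [set p in _ | _].
apply: (@leq_trans #|[set g @: E | E : {set 'I_t} in pull_edges g] :|:
    [set [set p.1; p.2] | p in P]|); last first.
  apply: leq_trans (leq_card_setU _ _) _.
  by apply: leq_add; apply: leq_imset_card.
apply: subset_leq_card; apply/subsetP => E EG.
have [x [y [Exy xy]]] := edgeP EG.
have gT x' : x' \in T -> exists i, x' = g i.
  by rewrite ET => /imsetP[i _ ->]; exists i.
rewrite in_setU; apply/orP.
have [xT|xT] := boolP (x \in T); have [yT|yT] := boolP (y \in T).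
- left; have [i Ei] := gT _ xT; have [j Ej] := gT _ yT.
  have Eij : g @: [set i; j] = E by rewrite imsetU1 imset_set1 -Ei -Ej.
  by apply/imsetP; exists [set i; j]; rewrite ?inE ?Eij.
- by right; apply/imsetP; exists (x, y); rewrite ?inE //= xT yT.
- right; apply/imsetP; exists (y, x); rewrite ?inE /= 1?setUC //.
  by rewrite xT yT adj_sym.
- by have := hT x y xT yT; rewrite xy.
Qed.

Lemma upper_bound t (F G : graph) : 1 < t -> two_connected G ->
  free (add_graph (cycles_ge t.*2.+1) F) G ->
  cover_bound t + t + 2 ^ t + #|vertex F| < #|vertex G| ->
  #|edge_set G| <= ex_num t (covering_family F) + t * (#|vertex G| - t).
Proof.
move=> t1 conG freeG nG; set n := #|vertex G| in nG *.
have [small|large] := leqP #|edge_set G| (t * (n - t)).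
  by apply: leq_trans small (leq_addl _ _).
have hc : circumference_le (@adj G) (2 * t).
  apply: free_circumference; first by lia.
  by move=> H HH; apply: freeG; left; rewrite mul2n in HH.
have [||T cT hT] := exists_cover t1 (@adj_sym G) (@adj_irr G)
    (two_connected_no_cut conG) hc.
- by apply: leq_ltn_trans nG; lia.
- by rewrite -edge_set_adj; apply: ltnW.
pose g (i : 'I_t) : vertex G := enum_val (cast_ord (esym cT) i).
have g_inj : injective g by move=> i j /enum_val_inj/cast_ord_inj.
have ET : T = g @: [set: 'I_t].
  apply/esym/eqP; rewrite eqEcard card_imset // cardsT card_ord cT leqnn andbT.
  by apply/subsetP => _ /imsetP[i _ ->]; apply: enum_valP.
have cE := card_edges_cover g_inj ET hT; set P := [set p in _ | _] in cE.
have cTN : #|setX T (~: T)| = t * (n - t) by rewrite cardsX cT cardsCs setCK cT.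
pose NP := setX T (~: T) :\: P.
have cP : #|P| + #|NP| = t * (n - t).
  rewrite -cTN -(cardsID P (setX T (~: T))) (setIidPr _) //.
  by apply/subsetP => p; rewrite inE => /andP[].
pose Q := pull g_inj.
suff freeQ : free (covering_family F) (Graph Q).
  apply: leq_trans cE _; apply: leq_add; last by rewrite -cP leq_addr.
  by apply: (leq_bigmax_cond (P := fun Q : graph_on 'I_t => _)
      (F := fun Q => #|edges Q|) Q); apply/asboolP.
move=> H [S covS ->] cont; apply: (freeG F); first by right.
(* Each vertex outside [T] and [W] misses a pair in [NP]. As there are more than [t * (n - t)]
   edges, [NP] is smaller than the number of edges inside [T], for which the crude bound [2 ^ t]
   suffices. *)
pose W := [set w in ~: T | [forall u in T, adj u w]].
have cW : #|vertex F| <= #|W|.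
  have cQ : #|pull_edges g| <= 2 ^ t.
    rewrite -[t in 2 ^ t]card_ord -cardsT -card_powerset; apply: subset_leq_card.
    by apply/subsetP => E _; rewrite inE subsetT.
  have cWc : #|~: T :\: W| <= #|NP|.
    apply: leq_trans (leq_imset_card (fun p : vertex G * vertex G => p.2) NP).
    apply: subset_leq_card; apply/subsetP => w; rewrite !inE => /andP[nW wT].
    move: nW; rewrite wT /= => /forall_inPn[u uT nuw].
    by apply/imsetP; exists (u, w); rewrite // !inE /= uT wT nuw.
  have cC : #|~: T| = n - t by rewrite cardsCs setCK cT.
  have := cardsID W (~: T); rewrite (setIidPr _); last first.
    by apply/subsetP => w; rewrite inE => /andP[].
  rewrite cC; move: cE large cP nG cWc cQ.
  move: (#|edge_set G|) (#|pull_edges g|) (#|P|) (#|NP|) (#|W|) (#|_ :\: W|)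
    (#|vertex F|) (cover_bound t) (t * (n - t)) (2 ^ t).
  by clear; lia.
apply: extend_embedding covS cont cW _.
move=> u w; rewrite !inE => /andP[wT /forall_inP h].
have gT : g u \in T by apply: enum_valP.
by split; [apply: h|apply: contraNneq wT => <-].
Qed.

Theorem theorem4 (k : nat) (hk : 5 <= k) (hodd : odd k) (F : graph)
    (hF : le_inf ((k - 1) %/ 2 + 1) (small_class F)) :
  let t := (k - 1) %/ 2 in
  let Fs := add_graph (cycles_ge k) F in
  let Hs := covering_family F in
  exists n0 : nat, forall n : nat, n0 <= n ->
    ex_num_2conn n Fs = ex_num t Hs + t * (n - t).
Proof.
set t := (k - 1) %/ 2 in hF *; move=> /=.
have Ek : k = t.*2.+1.
  by rewrite /t -{1}(odd_double_half k) hodd -divn2; lia.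
have t1 : 1 < t by lia.
(* The threshold of [upper_bound]; the last summand also gives [t.+1 < n], needed for the join to be
   2-connected. *)
exists (cover_bound t + t + 2 ^ t + #|vertex F| + 2) => n hn.
have tn : t <= n by lia.
apply/eqP; rewrite eqn_leq; apply/andP; split.
  apply/bigmax_leqP => G /asboolP[conG freeG].
  have := @upper_bound t F (Graph G) t1 conG.
  rewrite -Ek /= card_ord; apply=> //; apply: leq_trans hn.
  by rewrite addn2 ltnS leqnSn.
have [|Q freeQ <-] := @ex_num_attained t (covering_family F).
  by exists (empty_graph t); apply: empty_graph_free.
rewrite -(join_edges_card tn).
apply: (leq_bigmax_cond (P := fun G : graph_on 'I_n => _)
  (F := fun G => #|edges G|) (join_graph tn Q)).
apply/asboolP; split; first by apply: join_two_connected; lia.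
move=> H [|->]; last exact: join_free_graph.
by apply: join_free_cycles; lia.
Qed.
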